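(* $\Lambda_1=\Lambda_2=1$, $\frac{\sqrt3}{2}\leq\Lambda_4\leq1$, and $\Lambda_n=\frac{\sqrt3}{2}$ for every $n\in(\mathbb{N}\cup\{\infty\})\setminus\{1,2,4\}$. Moreover, for $n\neq4$ there exist $g\in L_\infty(\Omega_n)$, $T\in\mathrm{Aut}_n$ and $z\in\mathbb{C}$ such that $\Lambda(g,T,z)=\Lambda(g)=\Lambda_n$.
   Context: For $n\in\mathbb{N}$, $(\Omega_n,\mu_n)$ is $\{1,\dots,n\}$ with normalized counting measure; $(\Omega_\infty,\mu_\infty)$ is $[0,1]$ with Lebesgue measure. $S(\Omega_n)$ is the set of complex measurable functions on $\Omega_n$; $\mathrm{Aut}_n$ the group of measure-preserving automorphisms (measurable bijections between full-measure subsets, with measurable inverse, preserving $\mu_n$). For $g\in S(\Omega_n)$, $T\in\mathrm{Aut}_n$, $z\in\mathbb{C}$: $\Lambda(g,T,z)=\operatorname{ess\,inf}\frac{|g-g\circ T|}{|g-z|+|g\circ T-z|}$ with $\frac00=1$; $\Lambda(g)=\sup_{T,z}\Lambda(g,T,z)$; $\Lambda_n=\inf_{g\in S(\Omega_n)}\Lambda(g)$. *)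

(* Defs.v *)
From HB Require Import structures.
From mathcomp Require Import all_boot all_order all_algebra.
From mathcomp Require Import all_classical all_reals all_analysis.
From mathcomp Require Import complex.

Set Implicit Arguments.
Unset Strict Implicit.
Unset Printing Implicit Defensive.

Import Order.TTheory GRing.Theory Num.Theory.
Import numFieldNormedType.Exports.

Local Open Scope classical_set_scope.
Local Open Scope ring_scope.

Definition cabs {R : realType} (z : R[i]) : R := Normc.normc z.

Section Lambda_general.
(* A measure space (Omega, mu) given as a measurable subset [D] of an ambient
   measurable type [T] equipped with a measure [mu]; only the trace of [mu] on
   [D] matters. *)
Context {R : realType} {d : measure_display} {T : measurableType d}.
Variables (mu : {measure set T -> \bar R}) (D : set T).

Definition cmeas (g : T -> R[i]) : Prop :=
  measurable_fun D (fun x => complex.Re (g x)) /\ measurable_fun D (fun x => complex.Im (g x)).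

Definition Linfty (g : T -> R[i]) : Prop :=
  cmeas g /\ exists M : R, \forall x \ae mu, D x -> cabs (g x) <= M.

Definition is_aut (S : T -> T) : Prop :=
  exists (A B : set T) (S' : T -> T),
    [/\ measurable A, measurable B, A `<=` D, B `<=` D &
        (mu (D `\` A) = 0)%E /\ (mu (D `\` B) = 0)%E ] /\
    [/\ set_bij A B S, (forall x, A x -> S' (S x) = x),
        (forall y, B y -> S' y \in A /\ S (S' y) = y),
        measurable_fun A S & measurable_fun B S' ] /\
    (forall E, measurable E -> E `<=` D -> mu (A `&` S @^-1` E) = mu E).

(* pointwise quotient |g - g o S| / (|g - z| + |g o S - z|), with 0/0 = 1 *)
Definition lam_ratio (g : T -> R[i]) (S : T -> T) (z : R[i]) (x : T) : R :=
  let den := cabs (g x - z) + cabs (g (S x) - z) in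
  if den == 0 then 1 else cabs (g x - g (S x)) / den.

Definition ess_inf_on (f : T -> R) : \bar R :=
  ereal_sup [set y : \bar R | \forall x \ae mu, D x -> (y <= (f x)%:E)%E].

Definition Lam (g : T -> R[i]) (S : T -> T) (z : R[i]) : \bar R :=
  ess_inf_on (lam_ratio g S z).

Definition Lam_sup (g : T -> R[i]) : \bar R :=
  ereal_sup [set Lam g S z | S in is_aut & z in [set: R[i]]].

Definition Lam_space : \bar R :=
  ereal_inf [set Lam_sup g | g in cmeas].

End Lambda_general.

(* Omega_n = {1, ..., n} inside nat (discrete sigma-algebra), with normalized
   counting measure mu_n = (1/n) * counting. *)
Definition Omega_fin (n : nat) : set nat := [set k | (1 <= k <= n)%N].

Definition inv_nat_nng {R : realType} (n : nat) : {nonneg R} :=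
  @NngNum R (n%:R^-1) (eq_ind_r is_true (ler0n R n) (invr_ge0 (n%:R : R))).

Definition mu_fin {R : realType} (n : nat) : {measure set nat -> \bar R} :=
  mscale (inv_nat_nng n) (@counting nat R).

(* Omega_infty = [0,1] inside R with (completed) Lebesgue measure, i.e. the
   Lebesgue sigma-algebra. *)
Definition mu_inf {R : realType} := @completed_lebesgue_measure R.

Definition Omega_inf {R : realType} : set R := `[0%R, 1%R].

Definition Lambda_fin {R : realType} (n : nat) : \bar R :=
  Lam_space (@mu_fin R n) (Omega_fin n).

Definition Lambda_inf {R : realType} : \bar R :=
  Lam_space (@mu_inf R) (@Omega_inf R).

(* Main.v *)
(* The ratio at a pair of values p, q is at least sqrt 3 / 2 as soon as p and q
   are seen from z under an angle of at least 120 degrees.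

   Lower bound. An intermediate value argument gives, for every g, a point z and
   three lines through z at mutual angles of 60 degrees such that each of the six
   open half-planes carries at most half of the mass of g.  Splitting the mass on
   the lines into exact halves cuts Omega into pieces indexed by three signs:
   six closed 60-degree sectors at z and two pieces (+++), (---) on which g = z.
   The halving equations say that opposite pieces differ by one common excess.
   Points of opposite sectors make an angle >= 120 degrees and are paired; the
   excess consists of equal masses in three alternate sectors and at z, and among
   three points in alternate sectors two always make an angle >= 120 degrees,
   the third being paired with a point where g = z.  On [0, 1] pieces of equal
   mass are exchanged by piecewise rational translations; for finite n one doubles
   every point to make halves exact, and Hall's theorem turns the resulting
   pairing into a permutation.

   Upper bound. Let g take the vertices of an equilateral triangle as values,
   each with mass < 1/2.  For any z some vertex k is such that all ratios between
   the other vertices are at most sqrt 3 / 2 (the distances from z to the vertices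
   sum to at least 3 circumradii), and any automorphism maps a positive mass of
   the complement of g = k into itself. *)
Require Import Defs.
From HB Require Import structures.
From mathcomp Require Import all_boot all_order all_algebra.
From mathcomp Require Import all_classical all_reals all_analysis.
From mathcomp Require Import measurable_realfun complex zify ring lra.

Set Implicit Arguments.
Unset Strict Implicit.
Unset Printing Implicit Defensive.

Import Order.TTheory GRing.Theory Num.Theory.
Import numFieldNormedType.Exports.
Local Open Scope classical_set_scope.
Local Open Scope ring_scope.

(** * Angles of at least 120 degrees *)
Section plane_geometry.
Context {R : realType}.
Implicit Types (x y a b p q : R).

Definition norm2 x y : R := Num.sqrt (x ^+ 2 + y ^+ 2).

Lemma norm2_ge0 x y : 0 <= norm2 x y.
Proof. exact: sqrtr_ge0. Qed.

Lemma norm2_sqr x y : norm2 x y ^+ 2 = x ^+ 2 + y ^+ 2.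
Proof. by rewrite sqr_sqrtr // addr_ge0 ?sqr_ge0. Qed.

Lemma norm2_gt0 x y : (x != 0) || (y != 0) -> 0 < norm2 x y.
Proof.
by move=> xy; rewrite sqrtr_gt0 lt_def paddr_eq0 ?sqr_ge0 // !sqrf_eq0
  negb_and xy addr_ge0 ?sqr_ge0.
Qed.

Lemma sqrt3_sqr : Num.sqrt 3 ^+ 2 = 3 :> R.
Proof. by rewrite sqr_sqrtr. Qed.

Lemma sqrt3_ge0 : 0 <= Num.sqrt 3 :> R.
Proof. exact: sqrtr_ge0. Qed.

(* The law of cosines with an angle of at least 120 degrees. *)
Lemma norm2_sub_ge x y x' y' :
  2 * (x * x' + y * y') + norm2 x y * norm2 x' y' <= 0 ->
  Num.sqrt 3 / 2 * (norm2 x y + norm2 x' y') <= norm2 (x - x') (y - y').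
Proof.
have n1 := norm2_ge0 x y; have n2 := norm2_ge0 x' y'.
have n3 := norm2_ge0 (x - x') (y - y').
have s1 := norm2_sqr x y; have s2 := norm2_sqr x' y'.
have s3 := norm2_sqr (x - x') (y - y').
have r0 := sqrt3_ge0; have r3 := sqrt3_sqr.
move: (norm2 x y) (norm2 x' y') (norm2 (x - x') (y - y')) (Num.sqrt 3) n1 n2 n3 s1 s2 s3 r0 r3.
move=> A B C r n1 n2 n3 s1 s2 s3 r0 r3 h.
rewrite -(@ler_pXn2r _ 2) ?nnegrE ?mulr_ge0 ?addr_ge0 ?invr_ge0 //.
rewrite s3 exprMn expr_div_n r3.
(* The hypothesis gives [C ^+ 2 >= A ^+ 2 + A * B + B ^+ 2], and this lower bound exceeds
   [3 / 4 * (A + B) ^+ 2] by [(A - B) ^+ 2 / 4]. *)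
have := sqr_ge0 (A - B); nra.
Qed.

(** The three forms are the scalar products of [(x, y)] with [(a, b)] and with its rotations by 120
    and 240 degrees. *)
Definition lf0 a b x y := a * x + b * y.
Definition lf1 a b x y :=
  (- a / 2 - Num.sqrt 3 / 2 * b) * x + (Num.sqrt 3 / 2 * a - b / 2) * y.
Definition lf2 a b x y :=
  (- a / 2 + Num.sqrt 3 / 2 * b) * x + (- (Num.sqrt 3 / 2 * a) - b / 2) * y.

Lemma lf_sum0 a b x y : lf0 a b x y + lf1 a b x y + lf2 a b x y = 0.
Proof. by rewrite /lf0 /lf1 /lf2; field. Qed.

(** Three vectors of equal length at mutual angles of 120 degrees form a tight frame, so the three
    forms determine scalar products up to a constant factor. *)
Lemma lf_dot a b x y x' y' :
  lf0 a b x y * lf0 a b x' y' + lf1 a b x y * lf1 a b x' y' +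
  lf2 a b x y * lf2 a b x' y' = 3 / 2 * (a ^+ 2 + b ^+ 2) * (x * x' + y * y').
Proof.
rewrite /lf0 /lf1 /lf2; have := sqrt3_sqr; move: (Num.sqrt 3) => r r3.
transitivity (3 / 2 * ((a * x + b * y) * (a * x' + b * y')) +
  r ^+ 2 / 2 * ((a * y - b * x) * (a * y' - b * x'))); first by field.
by rewrite r3; field.
Qed.

(** In a basis of two unit vectors at 60 degrees, [p ^+ 2 + p * q + q ^+ 2] is a squared norm and
    the base of the right-hand square is twice a scalar product: two vectors of a 60-degree cone
    have cosine at least 1/2. *)
Lemma cone60 p q p' q' : 0 <= p -> 0 <= q -> 0 <= p' -> 0 <= q' ->
  (p ^+ 2 + p * q + q ^+ 2) * (p' ^+ 2 + p' * q' + q' ^+ 2) <=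
  (2 * p * p' + 2 * q * q' + p * q' + q * p') ^+ 2.
Proof.
move=> p0 q0 p0' q0'; rewrite -subr_ge0.
have -> : (2 * p * p' + 2 * q * q' + p * q' + q * p') ^+ 2 -
  (p ^+ 2 + p * q + q ^+ 2) * (p' ^+ 2 + p' * q' + q' ^+ 2) =
  3 * p ^+ 2 * p' ^+ 2 + 3 * q ^+ 2 * q' ^+ 2 + 9 * p * p' * q * q' +
  3 * p ^+ 2 * p' * q' + 3 * q ^+ 2 * p' * q' + 3 * p * q * p' ^+ 2 +
  3 * p * q * q' ^+ 2 by ring.
by rewrite !addr_ge0 // !mulr_ge0 // ?exprn_ge0.
Qed.

(** By pigeonhole two of the three coordinates have the same weak sign pattern. Up to rotation of
    the coordinates and exchange of the vectors these are the first two, with [l >= 0 >= m];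
    eliminating the third coordinate then leaves [cone60] for [l] and [- m]. *)
Lemma opposite_signs_dot (l0 l1 l2 m0 m1 m2 : R) :
  l0 + l1 + l2 = 0 -> m0 + m1 + m2 = 0 ->
  l0 * m0 <= 0 -> l1 * m1 <= 0 -> l2 * m2 <= 0 ->
  (l0 ^+ 2 + l1 ^+ 2 + l2 ^+ 2) * (m0 ^+ 2 + m1 ^+ 2 + m2 ^+ 2) <=
  4 * (l0 * m0 + l1 * m1 + l2 * m2) ^+ 2.
Proof.
have key (x0 x1 x2 y0 y1 y2 : R) : x0 + x1 + x2 = 0 -> y0 + y1 + y2 = 0 ->
    0 <= x0 -> 0 <= x1 -> y0 <= 0 -> y1 <= 0 ->
    (x0 ^+ 2 + x1 ^+ 2 + x2 ^+ 2) * (y0 ^+ 2 + y1 ^+ 2 + y2 ^+ 2) <=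
    4 * (x0 * y0 + x1 * y1 + x2 * y2) ^+ 2.
  move=> sx sy hx0 hx1 hy0 hy1.
  have -> : x2 = - (x0 + x1) by lra.
  have -> : y2 = - (y0 + y1) by lra.
  have := @cone60 x0 x1 (- y0) (- y1) hx0 hx1.
  by rewrite !oppr_ge0 => /(_ hy0 hy1); nra.
move=> sl sm h0 h1 h2.
have ge0_or (x y : R) : x * y <= 0 -> (0 <= x /\ y <= 0) \/ (x <= 0 /\ 0 <= y).
  move=> xy; case: (ltrgtP 0 x) => hx; case: (ltrgtP 0 y) => hy;
    try (by left; split; lra); try (by right; split; lra); nra.
have rot (x0 x1 x2 y0 y1 y2 : R) : 
    (x0 ^+ 2 + x1 ^+ 2 + x2 ^+ 2) * (y0 ^+ 2 + y1 ^+ 2 + y2 ^+ 2) <=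
    4 * (x0 * y0 + x1 * y1 + x2 * y2) ^+ 2 ->
    (x1 ^+ 2 + x2 ^+ 2 + x0 ^+ 2) * (y1 ^+ 2 + y2 ^+ 2 + y0 ^+ 2) <=
    4 * (x1 * y1 + x2 * y2 + x0 * y0) ^+ 2.
  by move=> h; lra.
have sym (x0 x1 x2 y0 y1 y2 : R) : 
    (y0 ^+ 2 + y1 ^+ 2 + y2 ^+ 2) * (x0 ^+ 2 + x1 ^+ 2 + x2 ^+ 2) <=
    4 * (y0 * x0 + y1 * x1 + y2 * x2) ^+ 2 ->
    (x0 ^+ 2 + x1 ^+ 2 + x2 ^+ 2) * (y0 ^+ 2 + y1 ^+ 2 + y2 ^+ 2) <=
    4 * (x0 * y0 + x1 * y1 + x2 * y2) ^+ 2.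
  by rewrite [y0 * x0]mulrC [y1 * x1]mulrC [y2 * x2]mulrC [X in X <= _ -> _]mulrC.
case: (ge0_or _ _ h0) => -[l0s m0s]; case: (ge0_or _ _ h1) => -[l1s m1s];
  case: (ge0_or _ _ h2) => -[l2s m2s].
- by apply: key; lra.
- by apply: key; lra.
- by apply/rot/key; lra.
- by apply/rot/rot/sym/key; lra.
- by apply/rot/rot/key; lra.
- by apply/rot/sym/key; lra.
- by apply/sym/key; lra.
- by apply/sym/key; lra.
Qed.

(** [lf_dot] translates [opposite_signs_dot] into [|u|^2 |v|^2 <= 4 (u.v)^2], and adding the three
    sign conditions gives [u.v <= 0], which fixes the sign of the square root. *)
Lemma lf_opposite_obtuse a b x y x' y' : (a != 0) || (b != 0) ->
  lf0 a b x y * lf0 a b x' y' <= 0 -> lf1 a b x y * lf1 a b x' y' <= 0 ->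
  lf2 a b x y * lf2 a b x' y' <= 0 ->
  2 * (x * x' + y * y') + norm2 x y * norm2 x' y' <= 0.
Proof.
move=> /norm2_gt0 ab h0 h1 h2.
have := opposite_signs_dot (lf_sum0 a b x y) (lf_sum0 a b x' y') h0 h1 h2.
rewrite !expr2 !lf_dot => H.
have {ab}k0 : 0 < a ^+ 2 + b ^+ 2 by rewrite -norm2_sqr exprn_gt0.
have hd : x * x' + y * y' <= 0.
  have := lf_dot a b x y x' y'; nra.
have k2 : 0 < (a ^+ 2 + b ^+ 2) ^+ 2 by rewrite exprn_gt0.
have {}H : (x ^+ 2 + y ^+ 2) * (x' ^+ 2 + y' ^+ 2) <= 4 * (x * x' + y * y') ^+ 2.
  rewrite -(ler_pM2l k2); move: H; rewrite !expr2; lra.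
have H' : norm2 x y * norm2 x' y' <= - (2 * (x * x' + y * y')).
  rewrite -(@ler_pXn2r _ 2) ?nnegrE ?mulr_ge0 ?norm2_ge0 //; last by lra.
  by rewrite exprMn !norm2_sqr; lra.
lra.
Qed.

(* If three vectors satisfy [al x + be y + ga w = 0] with positive weights,
   then the two with the larger [weight * norm] form an angle >= 120 degrees:
   |al x + be y|^2 = |ga w|^2 <= (al|x|)^2 - (al|x|)(be|y|) + (be|y|)^2. *)
Lemma obtuse_of_balance (al be ga x1 x2 y1 y2 w1 w2 : R) :
  0 < al -> 0 < be -> 0 < ga ->
  al * x1 + be * y1 + ga * w1 = 0 -> al * x2 + be * y2 + ga * w2 = 0 ->
  ga * norm2 w1 w2 <= al * norm2 x1 x2 -> ga * norm2 w1 w2 <= be * norm2 y1 y2 ->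
  2 * (x1 * y1 + x2 * y2) + norm2 x1 x2 * norm2 y1 y2 <= 0.
Proof.
move=> al0 be0 ga0 e1 e2.
have n1 := norm2_ge0 x1 x2; have n2 := norm2_ge0 y1 y2.
have n3 := norm2_ge0 w1 w2.
have s1 := norm2_sqr x1 x2; have s2 := norm2_sqr y1 y2.
have s3 := norm2_sqr w1 w2.
move: (norm2 x1 x2) (norm2 y1 y2) (norm2 w1 w2) n1 n2 n3 s1 s2 s3.
move=> X Y W n1 n2 n3 s1 s2 s3 h1 h2.
have ab : 0 < al * be by rewrite mulr_gt0.
rewrite -(pmulr_rle0 _ ab).
have eW : (ga * W) ^+ 2 = (al * X) ^+ 2 + (be * Y) ^+ 2 + 2 * (al * be) * (x1 * y1 + x2 * y2).
  rewrite !exprMn s1 s2 s3.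
  have f1 : ga * w1 = - (al * x1 + be * y1) by lra.
  have f2 : ga * w2 = - (al * x2 + be * y2) by lra.
  have -> : ga ^+ 2 * (w1 ^+ 2 + w2 ^+ 2) = (ga * w1) ^+ 2 + (ga * w2) ^+ 2 by ring.
  by rewrite f1 f2; ring.
have p1 : 0 <= ga * W by rewrite mulr_ge0 // ltW.
have p2 : 0 <= al * X by rewrite mulr_ge0 // ltW.
have p3 : 0 <= be * Y by rewrite mulr_ge0 // ltW.
(* If [C] is at most the smaller of [A] and [B], then [C ^+ 2] is at most the square of that one,
   and [A ^+ 2 - A * B + B ^+ 2] exceeds this square by the larger one times their difference. *)
have : (ga * W) ^+ 2 <= (al * X) ^+ 2 - (al * X) * (be * Y) + (be * Y) ^+ 2.
  move: (ga * W) (al * X) (be * Y) p1 p2 p3 h1 h2 => C A B.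
  by move=> *; case: (leP A B) => ?; nra.
rewrite eW; lra.
Qed.

(** The cosine is at most -1/2. Without division the zero vector is obtuse to every vector, as the
    points with [g = z] require. *)
Definition obtuse (x1 x2 y1 y2 : R) :=
  2 * (x1 * y1 + x2 * y2) + norm2 x1 x2 * norm2 y1 y2 <= 0.

(** Any two cyclically successive vectors among the three span the same oriented area
    [Num.sqrt 3 / 2 * (a ^+ 2 + b ^+ 2)], hence the common factor. *)
Lemma lf_cross a b x y x' y' :
  [/\ lf1 a b x y * lf2 a b x' y' - lf2 a b x y * lf1 a b x' y' =
       Num.sqrt 3 / 2 * (a ^+ 2 + b ^+ 2) * (x * y' - y * x'),
      lf2 a b x y * lf0 a b x' y' - lf0 a b x y * lf2 a b x' y' =
       Num.sqrt 3 / 2 * (a ^+ 2 + b ^+ 2) * (x * y' - y * x') &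
      lf0 a b x y * lf1 a b x' y' - lf1 a b x y * lf0 a b x' y' =
       Num.sqrt 3 / 2 * (a ^+ 2 + b ^+ 2) * (x * y' - y * x')].
Proof. by rewrite /lf0 /lf1 /lf2; split; field. Qed.

(** If the determinants of the successive pairs are all positive, they are the weights of a
    vanishing combination of the three vectors, and [obtuse_of_balance] applies after setting aside
    the vector of least weighted norm. A determinant [<= 0] can only come from the sector
    boundaries, and there [lf_opposite_obtuse] applies to the pair. *)
Lemma lf_alternate_obtuse a b x1 x2 y1 y2 w1 w2 : (a != 0) || (b != 0) ->
  lf1 a b x1 x2 <= 0 -> lf2 a b x1 x2 <= 0 ->
  lf0 a b y1 y2 <= 0 -> lf2 a b y1 y2 <= 0 ->
  lf0 a b w1 w2 <= 0 -> lf1 a b w1 w2 <= 0 ->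
  [\/ obtuse x1 x2 y1 y2, obtuse x1 x2 w1 w2 | obtuse y1 y2 w1 w2].
Proof.
move=> ab hx1 hx2 hy0 hy2 hw0 hw1.
have hx0 : 0 <= lf0 a b x1 x2 by have := lf_sum0 a b x1 x2; lra.
have hy1 : 0 <= lf1 a b y1 y2 by have := lf_sum0 a b y1 y2; lra.
have hw2 : 0 <= lf2 a b w1 w2 by have := lf_sum0 a b w1 w2; lra.
have k0 : 0 < Num.sqrt 3 / 2 * (a ^+ 2 + b ^+ 2).
  by rewrite !mulr_gt0 ?invr_gt0 ?sqrtr_gt0 // -norm2_sqr exprn_gt0 // norm2_gt0.
(* The signs give [l1 * m2 >= 0 >= l2 * m1], so a difference [<= 0] forces both products to
   vanish. *)
have deg (l0 l1 l2 m0 m1 m2 : R) : l0 + l1 + l2 = 0 -> m0 + m1 + m2 = 0 ->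
    l1 <= 0 -> l2 <= 0 -> m0 <= 0 -> m2 <= 0 -> l1 * m2 - l2 * m1 <= 0 ->
    [/\ l0 * m0 <= 0, l1 * m1 <= 0 & l2 * m2 <= 0].
  move=> sl sm h1 h2 h3 h4 h5.
  have e0 : 0 <= l0 by lra.
  have e1 : 0 <= m1 by lra.
  have p1 : 0 <= l1 * m2 by rewrite mulr_le0.
  have p2 : l2 * m1 <= 0 by rewrite mulr_le0_ge0.
  have [q1 q2] : l1 * m2 = 0 /\ l2 * m1 = 0 by lra.
  split; [by rewrite mulr_ge0_le0|by rewrite mulr_le0_ge0|].
  move/eqP : q2; rewrite mulf_eq0 => /orP[/eqP->|/eqP m10]; first by rewrite mul0r.
  have -> : m2 = 0 by lra.
  by rewrite mulr0.
have [c1 _ _] := lf_cross a b x1 x2 y1 y2.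
have [_ c2 _] := lf_cross a b y1 y2 w1 w2.
have [_ _ c3] := lf_cross a b w1 w2 x1 x2.
have [ga0|ga0] := leP (x1 * y2 - x2 * y1) 0.
  apply: Or31.
  have [|h0 h1 h2] := deg _ _ _ _ _ _ (lf_sum0 a b x1 x2) (lf_sum0 a b y1 y2) hx1 hx2 hy0 hy2.
    by rewrite c1 pmulr_rle0.
  exact: (lf_opposite_obtuse ab).
have [al0|al0] := leP (y1 * w2 - y2 * w1) 0.
  apply: Or33.
  have [|||h1 h2 h0] := deg (lf1 a b y1 y2) (lf2 a b y1 y2) (lf0 a b y1 y2)
     (lf1 a b w1 w2) (lf2 a b w1 w2) (lf0 a b w1 w2) _ _ hy2 hy0 hw1 hw0.
  - by have := lf_sum0 a b y1 y2; lra.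
  - by have := lf_sum0 a b w1 w2; lra.
  - by rewrite c2 pmulr_rle0.
  exact: (lf_opposite_obtuse ab).
have [be0|be0] := leP (w1 * x2 - w2 * x1) 0.
  apply: Or32.
  have [|||h2 h0 h1] := deg (lf2 a b w1 w2) (lf0 a b w1 w2) (lf1 a b w1 w2)
     (lf2 a b x1 x2) (lf0 a b x1 x2) (lf1 a b x1 x2) _ _ hw0 hw1 hx2 hx1.
  - by have := lf_sum0 a b w1 w2; lra.
  - by have := lf_sum0 a b x1 x2; lra.
  - by rewrite c3 pmulr_rle0.
  by apply: (lf_opposite_obtuse ab); rewrite mulrC.
(* Cramer's rule: each vector is weighted by the determinant of the other two. *)
set al := y1 * w2 - y2 * w1 in al0; set be := w1 * x2 - w2 * x1 in be0.
set ga := x1 * y2 - x2 * y1 in ga0.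
have e1 : al * x1 + be * y1 + ga * w1 = 0 by rewrite /al /be /ga; ring.
have e2 : al * x2 + be * y2 + ga * w2 = 0 by rewrite /al /be /ga; ring.
case: (leP (ga * norm2 w1 w2) (al * norm2 x1 x2)) => h1;
  case: (leP (ga * norm2 w1 w2) (be * norm2 y1 y2)) => h2.
- by apply: Or31; exact: (@obtuse_of_balance al be ga _ _ _ _ w1 w2).
- apply: Or32; apply: (@obtuse_of_balance al ga be _ _ _ _ y1 y2) => //; lra.
- apply: Or33; apply: (@obtuse_of_balance be ga al _ _ _ _ x1 x2) => //; lra.
- case: (leP (al * norm2 x1 x2) (be * norm2 y1 y2)) => h3.
    apply: Or33; apply: (@obtuse_of_balance be ga al _ _ _ _ x1 x2) => //; lra.
  apply: Or32; apply: (@obtuse_of_balance al ga be _ _ _ _ y1 y2) => //; lra.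
Qed.

Lemma cabsE (z : R[i]) : cabs z = norm2 (complex.Re z) (complex.Im z).
Proof. by case: z. Qed.

Lemma cabs_ge0 (z : R[i]) : 0 <= cabs z.
Proof. by rewrite cabsE norm2_ge0. Qed.

(** Multiplied out, the inequality also holds for [p = q = z], in agreement with 0/0 = 1. *)
Definition wide (z p q : R[i]) : bool :=
  Num.sqrt 3 / 2 * (cabs (p - z) + cabs (q - z)) <= cabs (p - q).

Lemma wide_obtuse (z p q : R[i]) :
  obtuse (complex.Re (p - z)) (complex.Im (p - z))
         (complex.Re (q - z)) (complex.Im (q - z)) -> wide z p q.
Proof.
move=> /norm2_sub_ge; rewrite /wide !cabsE.
suff [-> ->] : complex.Re (p - z) - complex.Re (q - z) = complex.Re (p - q) /\
    complex.Im (p - z) - complex.Im (q - z) = complex.Im (p - q) by [].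
by case: p q z => [p1 p2] [q1 q2] [z1 z2] /=; split; lra.
Qed.

Lemma wide_sym (z p q : R[i]) : wide z p q = wide z q p.
Proof.
rewrite /wide [cabs (p - z) + _]addrC; congr (_ <= _).
by rewrite !cabsE; case: p q => [p1 p2] [q1 q2] /=; congr Num.sqrt; ring.
Qed.
End plane_geometry.

(** * Three concurrent halving lines *)
(** Connectedness of [0, 1]: the supremum of the part of [U] in [0, 1] is in neither set, since [U]
    would continue beyond it and [V] would meet the points of [U] at or just below it. *)
Lemma no_open_partition01 (R : realType) (U V : R -> Prop) :
  (forall s, U s -> exists2 e, 0 < e & forall s', `|s' - s| < e -> U s') ->
  (forall s, V s -> exists2 e, 0 < e & forall s', `|s' - s| < e -> V s') ->
  (forall s, U s -> V s -> False) -> U 0 -> V 1 ->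
  exists s, ~ U s /\ ~ V s.
Proof.
move=> oU oV UV U0 V1; pose E := [set s | 0 <= s <= 1 /\ U s].
have E0 : E 0 by split => //; rewrite lexx ler01.
have hE : has_sup E.
  by split; [exists 0|exists 1 => s [/andP[]]].
have s0 : 0 <= sup E by apply: (sup_upper_bound hE).
have s1 : sup E <= 1 by apply: ge_sup => [|s [/andP[]]//]; exists 0.
exists (sup E); split.
  move=> Us; have [e e0 he] := oU _ Us.
  have {}s1 : sup E < 1.
    by rewrite lt_neqAle s1 andbT; apply/eqP => s1'; apply: (UV 1); rewrite -?s1'// s1'.
  pose m := Num.min (e / 2) ((1 - sup E) / 2).
  have m0 : 0 < m by rewrite lt_min; apply/andP; split; lra.
  have m1 : m <= e / 2 by rewrite ge_min lexx.
  have m2 : m <= (1 - sup E) / 2 by rewrite ge_min lexx orbT.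
  have : E (sup E + m).
    split; first by lra.
    by apply: he; rewrite addrAC subrr add0r ger0_norm; lra.
  by move/(sup_upper_bound hE); lra.
move=> Vs; have [e e0 he] := oV _ Vs.
have [s Es ss] := sup_adherent e0 hE.
have ss' := sup_upper_bound hE Es.
by case: Es => _ Us; apply: (UV s) => //; apply: he; rewrite ltr_norml; lra.
Qed.

Section medians.
Context {R : realType} {d : measure_display} {T : measurableType d}.
Variables (mu : {measure set T -> \bar R}) (D : set T).
Hypotheses (mD : measurable D) (muD : mu D = 1%E).

(** Continuity from below; all openness properties of [big] rest on it. *)
Lemma measure_bigcup_gt (F : (set T)^nat) (c : \bar R) :
  (forall i, measurable (F i)) -> (forall n, F n `<=` F n.+1) ->
  (c < mu (\bigcup_n F n))%E -> exists n, (c < mu (F n))%E.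
Proof.
move=> mF ndF cF; apply: contrapT => /forallNP h.
have nd : nondecreasing_seq F by apply/nondecreasing_seqP => n; apply/subsetPset; exact: ndF.
have cv : mu (F n) @[n --> \oo] --> mu (\bigcup_n F n).
  by apply: nondecreasing_cvg_mu => //; exact: bigcupT_measurable.
have : (lim (mu (F n) @[n --> \oo]) <= c)%E.
  apply: lime_le; first by apply/cvg_ex; exists (mu (\bigcup_n F n)).
  by apply: nearW => n; rewrite leNgt; apply/negP/h.
by rewrite (cvg_lim _ cv)// leNgt cF.
Qed.

Lemma measure_half_meet (A B : set T) : measurable A -> measurable B ->
  A `<=` D -> B `<=` D -> ((1 / 2)%:E < mu A)%E -> ((1 / 2)%:E < mu B)%E ->
  exists x, A x /\ B x.
Proof.
move=> mA mB AD BD hA hB; apply: contrapT => /forallNP h.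
have AB0 : A `&` B = set0 by apply/seteqP; split => // x [? ?]; case: (h x).
have : (mu (A `|` B) <= 1)%E.
  by rewrite -muD; apply: le_measure; rewrite ?inE//; [exact: measurableU|move=> x []; auto].
rewrite measureU// leNgt => /negP; apply.
by rewrite (_ : 1%E = ((1 / 2)%:E + (1 / 2)%:E)%E) ?lteD// -EFinD; congr EFin; lra.
Qed.

Variables (f1 f2 : T -> R).
Hypotheses (mf1 : measurable_fun D f1) (mf2 : measurable_fun D f2).

Definition above (a b t : R) := D `&` [set x | t < a * f1 x + b * f2 x].

Lemma measurable_lincomb a b : measurable_fun D (fun x => a * f1 x + b * f2 x).
Proof. by apply: measurable_funD; apply: measurable_funM. Qed.

Lemma measurable_above a b t : measurable (above a b t).
Proof.
rewrite /above (_ : [set x | _] = (fun x => a * f1 x + b * f2 x) @^-1` `]t, +oo[).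
  exact: (measurable_lincomb a b).
by apply/seteqP; split => x /=; rewrite in_itv/= andbT.
Qed.
Local Hint Resolve measurable_above : core.

(** Both inequalities, the one on values and the one on masses, are strict, which makes the
    condition open in the level and in the coefficients. *)
Definition big a b t := ((1 / 2)%:E < mu (above a b t))%E.

Lemma big_opp a b t t' : big a b t -> big (- a) (- b) t' -> t + t' < 0.
Proof.
move=> h h'.
have [x [[_ /= h1] [_ /= h2]]] := measure_half_meet (measurable_above _ _ _)
  (measurable_above _ _ _) (@subIsetl _ _ _) (@subIsetl _ _ _) h h'.
lra.
Qed.

Lemma big_bigcup a b t (F : (set T)^nat) :
  (forall i, measurable (F i)) -> (forall n, F n `<=` F n.+1) ->
  above a b t = \bigcup_n F n ->
  big a b t -> exists n, ((1 / 2)%:E < mu (F n))%E.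
Proof. by rewrite /big => mF nF ->; apply: measure_bigcup_gt. Qed.

Lemma big_le a b t t' : t' <= t -> big a b t -> big a b t'.
Proof.
move=> tt h; apply: (lt_le_trans h); apply: le_measure; rewrite ?inE//.
by move=> x [Dx /= ?]; split => //=; lra.
Qed.

Lemma natSinv_lt (e : R) : 0 < e -> exists n, n.+1%:R^-1 < e.
Proof.
by move=> e0; have [n _ hn] := near_infty_natSinv_lt (PosNum e0); exists n; exact: (hn n (leqnn n)).
Qed.

Lemma natSinv_le n : (n.+2%:R^-1 : R) <= n.+1%:R^-1.
Proof. by rewrite lef_pV2 ?posrE// ler_nat. Qed.

Lemma big_open_level a b t : big a b t -> exists2 t', t < t' & big a b t'.
Proof.
move=> h.
have [n hn] : exists n, ((1 / 2)%:E < mu (above a b (t + n.+1%:R^-1)))%E.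
  apply: (@big_bigcup a b t) => //.
    move=> n x [Dx /= xt]; split => //=; apply: le_lt_trans xt.
    by rewrite lerD2l natSinv_le.
  apply/seteqP; split => [x [Dx /= xt]|x [n _ [Dx /= xt]]].
    have [|n hn] := natSinv_lt (e := a * f1 x + b * f2 x - t); first by rewrite subr_gt0.
    by exists n => //; split => //=; rewrite addrC -ltrBrDr.
  split => //=; have : 0 < n.+1%:R^-1 :> R by [].
  by move: (n.+1%:R^-1) xt => e xt e0; lra.
by exists (t + n.+1%:R^-1) => //; rewrite ltrDl.
Qed.

(** At each point the value is affine in the parameter, so exceeding [t] at both ends of an interval
    implies exceeding it in between. The sets where this happens at both [s - 1/(n+1)] and
    [s + 1/(n+1)] increase to the set at [s], so one of them already has mass above 1/2. *)
Lemma big_open_path a b a' b' t s : big (a + s * a') (b + s * b') t ->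
  exists2 e, 0 < e & forall s', `|s' - s| < e -> big (a + s' * a') (b + s' * b') t.
Proof.
move=> h.
pose X s x := (a + s * a') * f1 x + (b + s * b') * f2 x.
have conv (n : nat) x s' : t < X (s - n.+1%:R^-1) x -> t < X (s + n.+1%:R^-1) x ->
    `|s' - s| <= n.+1%:R^-1 -> t < X s' x.
  rewrite ler_norml /X; have : 0 < n.+1%:R^-1 :> R by []; move: (n.+1%:R^-1) => e e0.
  move=> h1 h2 /andP[h3 h4].
  pose c := a' * f1 x + b' * f2 x.
  have -> : (a + s' * a') * f1 x + (b + s' * b') * f2 x =
    (a + (s - e) * a') * f1 x + (b + (s - e) * b') * f2 x + (s' - s + e) * c.
    by rewrite /c; ring.
  have h2' : t < (a + (s - e) * a') * f1 x + (b + (s - e) * b') * f2 x + (2 * e) * c.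
    by apply: (lt_le_trans h2); rewrite /c le_eqVlt; apply/orP; left; apply/eqP; ring.
  by case: (leP 0 c) => c0; nra.
have [n hn] : exists n, ((1 / 2)%:E < mu (above (a + (s - n.+1%:R^-1) * a') (b + (s - n.+1%:R^-1) * b') t
     `&` above (a + (s + n.+1%:R^-1) * a') (b + (s + n.+1%:R^-1) * b') t))%E.
  apply: (@big_bigcup (a + s * a') (b + s * b') t) => //.
  - by move=> n; exact: measurableI.
  - move=> n x [[Dx /= h1] [_ /= h2]]; split; split => //=;
     apply: (conv n) => //; rewrite addrAC subrr add0r ?normrN ger0_norm ?invr_ge0 //; exact: natSinv_le.
  - apply/seteqP; split => [x [Dx /= xt]|x [n _ [[Dx /= h1] [_ /= h2]]]]; last first.
      by split => //=; apply: (conv n) => //; rewrite subrr normr0.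
    pose c := a' * f1 x + b' * f2 x.
    (* [c] is the slope at [x]; the added 1 keeps the divisor positive when the slope vanishes. *)
    have c0 : 0 < 1 + `|c| by rewrite ltr_pwDl.
    have [|n hn] := natSinv_lt (e := (X s x - t) / (1 + `|c|)).
      by apply: divr_gt0; rewrite ?subr_gt0.
    exists n => //; have : 0 < n.+1%:R^-1 :> R by [].
    move: hn; move: (n.+1%:R^-1) => e; rewrite ltr_pdivlMr // => hn e0.
    have c1 := ler_norm c; have c2 := ler_norm (- c); rewrite normrN in c2.
    have hc : e * `|c| < X s x - t by nra.
    have [hc1 hc2] : e * c < X s x - t /\ - (e * c) < X s x - t by split; nra.
    split; split => //=.
      have -> : (a + (s - e) * a') * f1 x + (b + (s - e) * b') * f2 x = X s x - e * c by rewrite /X /c; ring.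
      lra.
    have -> : (a + (s + e) * a') * f1 x + (b + (s + e) * b') * f2 x = X s x + e * c by rewrite /X /c; ring.
    lra.
exists n.+1%:R^-1 => // s' /ltW s's.
apply: (lt_le_trans hn); apply: le_measure; rewrite ?inE//; first exact: measurableI.
by move=> x [[Dx /= h1] [_ /= h2]]; split => //=; exact: (conv n).
Qed.

Lemma big_exists a b : exists t, big a b t.
Proof.
have [n hn] : exists n, ((1 / 2)%:E < mu (above a b (- n%:R)))%E.
  apply: measure_bigcup_gt => //.
    by move=> n x [Dx /= ?]; split => //=; rewrite -natr1; lra.
  suff -> : \bigcup_n above a b (- n%:R) = D by rewrite muD lte_fin; lra.
  apply/seteqP; split => [x [n _ []]//|x Dx].
  exists (Num.truncn `|a * f1 x + b * f2 x|).+1 => //; split => //=.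
  rewrite ltrNl; apply: le_lt_trans (truncnS_gt _).
  by rewrite -normrN ler_norm.
by exists (- n%:R).
Qed.

(** The lower median of [a * f1 + b * f2]; the upper median is [- lmed (- a) (- b)]. *)
Definition lmed a b := sup [set t | big a b t].

Lemma lmed_has_sup a b : has_sup [set t | big a b t].
Proof.
split; first exact: big_exists.
have [t' ht'] := big_exists (- a) (- b).
by exists (- t') => t /= ht; have := big_opp ht ht'; lra.
Qed.

Lemma not_big_lmed a b t : lmed a b <= t -> ~ big a b t.
Proof.
move=> mt /big_open_level[t' tt' /(sup_upper_bound (lmed_has_sup a b))].
by rewrite -/(lmed a b); lra.
Qed.

Lemma big_lmed a b t : t < lmed a b -> big a b t.
Proof.
move=> tm; have [|t' /= ht' tt'] := sup_adherent (eps := lmed a b - t) _ (lmed_has_sup a b).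
  by rewrite subr_gt0.
by apply: big_le ht'; move: tt'; rewrite -/(lmed a b); lra.
Qed.

(** A positive sum would leave room for two opposite levels, one below each median, contradicting
    [big_opp]. *)
Lemma lmed_opp a b : lmed a b + lmed (- a) (- b) <= 0.
Proof.
rewrite leNgt; apply/negP => h.
have := @big_opp a b ((lmed a b - lmed (- a) (- b)) / 2) ((lmed (- a) (- b) - lmed a b) / 2).
by move=> /(_ (big_lmed _) (big_lmed _)); lra.
Qed.

Lemma lmed_sum_open (a b a' b' : 'I_3 -> R) s :
  0 < \sum_j lmed (a j + s * a' j) (b j + s * b' j) ->
  exists2 e, 0 < e & forall s', `|s' - s| < e ->
    0 < \sum_j lmed (a j + s' * a' j) (b j + s' * b' j).
Proof.
set m := fun j s => lmed (a j + s * a' j) (b j + s * b' j).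
rewrite -/(\sum_j m j s) => h; set M := \sum_j m j s in h.
(* Three terms that each drop by at most [M / 4] leave a sum of at least [M / 4]. *)
have open j : exists2 e, 0 < e & forall s', `|s' - s| < e -> m j s - M / 4 <= m j s'.
  have [|e e0 he] := @big_open_path (a j) (b j) (a' j) (b' j) (m j s - M / 4) s.
    by apply: big_lmed; rewrite -/(m j s); lra.
  exists e => // s' /he hs'.
  exact: (sup_upper_bound (lmed_has_sup _ _)).
have [e0 e00 h0] := open 0; have [e1 e10 h1] := open 1; have [e2 e20 h2] := open 2%:R.
exists (Num.min e0 (Num.min e1 e2)); first by rewrite !lt_min e00 e10.
move=> s'; rewrite !lt_min => /and3P[/h0 {}h0 /h1 {}h1 /h2 {}h2].
move: h0 h1 h2 h; rewrite /M -/(\sum_j m j s') !big_ord_recl !big_ord0 /=.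
have -> : lift ord0 ord0 = 1 :> 'I_3 by apply/val_inj.
have -> : lift ord0 (lift ord0 ord0) = 2%:R :> 'I_3 by apply/val_inj.
have -> : ord0 = 0 :> 'I_3 by [].
lra.
Qed.

Lemma lmed_sum_opp (a b : 'I_3 -> R) :
  \sum_j lmed (a j) (b j) + \sum_j lmed (- a j) (- b j) <= 0.
Proof.
rewrite -big_split /= -oppr_ge0 -sumrN sumr_ge0 // => j _.
by rewrite oppr_ge0 lmed_opp.
Qed.

Let r : R := Num.sqrt 3.
(** The vectors [p_j = (pa j, pb j)] are the unit vectors at 0, 120 and 240 degrees, and [q_j] is
    the next one after [p_j] cyclically. As [p_j + q_j] is the negative of the remaining vector, the
    affine path [p + s * q] replaces a rotation by 60 degrees. *)
Let pa (j : 'I_3) : R := [:: 1; - 1 / 2; - 1 / 2]`_j.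
Let pb (j : 'I_3) : R := [:: 0; r / 2; - r / 2]`_j.
Let qa (j : 'I_3) : R := [:: - 1 / 2; - 1 / 2; 1]`_j.
Let qb (j : 'I_3) : R := [:: r / 2; - r / 2; 0]`_j.

(** A positive sum of lower medians and a negative sum of upper medians are open, incompatible
    conditions on [s]. They exchange roles between [s = 0] and [s = 1], so by connectedness some [s]
    satisfies neither. *)
Lemma balanced_direction : exists s,
  \sum_j lmed (pa j + s * qa j) (pb j + s * qb j) <= 0 /\
  \sum_j lmed (- (pa j + s * qa j)) (- (pb j + s * qb j)) <= 0.
Proof.
pose U s := 0 < \sum_j lmed (pa j + s * qa j) (pb j + s * qb j).
pose V s := 0 < \sum_j lmed (- (pa j + s * qa j)) (- (pb j + s * qb j)).
have VE s : V s = (0 < \sum_j lmed (- pa j + s * - qa j) (- pb j + s * - qb j)).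
  by congr (0 < _); apply: eq_bigr => j _; congr lmed; ring.
have oU s : U s -> exists2 e, 0 < e & forall s', `|s' - s| < e -> U s'.
  exact: lmed_sum_open.
have oV s : V s -> exists2 e, 0 < e & forall s', `|s' - s| < e -> V s'.
  rewrite VE => /(@lmed_sum_open (fun j => - pa j) (fun j => - pb j)
    (fun j => - qa j) (fun j => - qb j))[e e0 he].
  by exists e => // s' /he; rewrite VE.
have UV s : U s -> V s -> False.
  have := lmed_sum_opp (fun j => pa j + s * qa j) (fun j => pb j + s * qb j).
  by rewrite /U /V; lra.
have VU s : V s -> U s -> False by move=> ? /UV; exact.
(* At [s = 1] the directions are the negatives of those at [s = 0], in another order. *)
have U1 : V 1 = U 0.
  rewrite /U /V !big_ord_recl !big_ord0 /pa /pb /qa /qb /=.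
  congr (0 < _); rewrite !addr0 addrCA; congr (_ + _); last rewrite addrC; try congr (_ + _);
  congr lmed; lra.
have V1 : U 1 = V 0.
  rewrite /U /V !big_ord_recl !big_ord0 /pa /pb /qa /qb /=.
  congr (0 < _); rewrite !addr0 addrCA; congr (_ + _); last rewrite addrC; try congr (_ + _);
  congr lmed; lra.
suff [s [/negP Us /negP Vs]] : exists s, ~ U s /\ ~ V s.
  by exists s; rewrite !leNgt; split.
case: (boolP (U 0)) => U0; first by apply: no_open_partition01; rewrite ?U1.
case: (boolP (V 0)) => V0; last by exists 0; split; apply/negP.
have [|s [? ?]] := no_open_partition01 oV oU VU V0; first by rewrite V1.
by exists s.
Qed.

Definition median_form (l : T -> R) :=
  (mu (D `&` [set x | (0 < l x)%R]) <= (1 / 2)%:E)%E /\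
  (mu (D `&` [set x | (l x < 0)%R]) <= (1 / 2)%:E)%E.

Lemma median_formP c1 c2 t z1 z2 : c1 * z1 + c2 * z2 = t ->
  lmed c1 c2 <= t <= - lmed (- c1) (- c2) ->
  median_form (fun x => c1 * (f1 x - z1) + c2 * (f2 x - z2)).
Proof.
move=> e /andP[h1 h2]; split; rewrite leNgt; apply/negP.
  have := @not_big_lmed c1 c2 t h1; rewrite /big /above.
  suff -> : [set x | t < c1 * f1 x + c2 * f2 x] =
    [set x | 0 < c1 * (f1 x - z1) + c2 * (f2 x - z2)] by [].
  by apply/seteqP; split => x /=; lra.
have := @not_big_lmed (- c1) (- c2) (- t); rewrite lerNr => /(_ h2); rewrite /big /above.
suff -> : [set x | - t < - c1 * f1 x + - c2 * f2 x] =
  [set x | c1 * (f1 x - z1) + c2 * (f2 x - z2) < 0] by [].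
by apply/seteqP; split => x /=; lra.
Qed.

(** The lower medians in the balanced directions sum to at most 0 and the upper ones to at least 0,
    so medians [t j] with sum 0 can be chosen. As the three directions also sum to 0, the lines at
    these levels pass through one point. *)
Lemma concurrent_medians : exists a b z1 z2 : R, [/\ (a != 0) || (b != 0),
  median_form (fun x => lf0 a b (f1 x - z1) (f2 x - z2)),
  median_form (fun x => lf1 a b (f1 x - z1) (f2 x - z2)) &
  median_form (fun x => lf2 a b (f1 x - z1) (f2 x - z2))].
Proof.
have [s [hl hu]] := balanced_direction.
pose va j := pa j + s * qa j; pose vb j := pb j + s * qb j.
pose lo j := lmed (va j) (vb j); pose up j := - lmed (- va j) (- vb j).
have lu j : lo j <= up j by have := lmed_opp (va j) (vb j); rewrite /lo /up; lra.
have [t [ht st]] : exists t : 'I_3 -> R, (forall j, lo j <= t j <= up j) /\ \sum_j t j = 0.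
  have hL : \sum_j lo j <= 0 by [].
  have hU : 0 <= \sum_j up j by rewrite sumrN oppr_ge0.
  have [e|ne] := eqVneq (\sum_j lo j) (\sum_j up j).
    exists lo; split => [j|]; [by rewrite lexx lu|lra].
  have dlt : 0 < \sum_j up j - \sum_j lo j by rewrite subr_gt0 lt_neqAle ne; lra.
  (* Interpolating between [lo] and [up] with this coefficient makes the sum vanish. *)
  pose k := - (\sum_j lo j) / (\sum_j up j - \sum_j lo j).
  have k0 : 0 <= k by rewrite divr_ge0 ?oppr_ge0 // ltW.
  have k1 : k <= 1 by rewrite ler_pdivrMr // mul1r; lra.
  exists (fun j => lo j + k * (up j - lo j)); split => [j|].
    by have := lu j; nra.
  by rewrite big_split /= -mulr_sumr sumrB /k mulfVK ?gt_eqF//; lra.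
pose o0 : 'I_3 := @Ordinal 3 0 isT; pose o1 : 'I_3 := @Ordinal 3 1 isT.
pose o2 : 'I_3 := @Ordinal 3 2 isT.
have r3 : r ^+ 2 = 3 by exact: sqrt3_sqr.
have r3s : s * (r * r) = s * 3 by rewrite -expr2 r3.
pose a := va o0; pose b := vb o0.
have va1 : va o1 = - a / 2 - r / 2 * b.
  by rewrite /a /b /va /vb /pa /pb /qa /qb /=; lra.
have va2 : va o2 = - a / 2 + r / 2 * b.
  by rewrite /a /b /va /vb /pa /pb /qa /qb /=; lra.
have vb1 : vb o1 = r / 2 * a - b / 2.
  by rewrite /a /b /va /vb /pa /pb /qa /qb /=; lra.
have vb2 : vb o2 = - (r / 2 * a) - b / 2.
  by rewrite /a /b /va /vb /pa /pb /qa /qb /=; lra.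
have ab : (a != 0) || (b != 0).
  have r0 : 0 < r by rewrite sqrtr_gt0.
  rewrite -negb_and; apply/negP => /andP[/eqP].
  rewrite /a /b /va /vb /pa /pb /qa /qb /= => ea.
  (* The first direction is [(1 - s / 2, s * r / 2)]: its first coordinate vanishes only at [s = 2],
     where the second one is [r]. *)
  have -> : s = 2 by lra.
  by rewrite add0r mulf_eq0 => /orP[|/eqP]; rewrite ?pnatr_eq0//; lra.
have k0 : a ^+ 2 + b ^+ 2 != 0 by rewrite gt_eqF // -norm2_sqr exprn_gt0 // norm2_gt0.
have {}st : t o0 + t o1 + t o2 = 0.
  move: st; rewrite !big_ord_recl big_ord0 addr0 addrA /= => <-.
  by congr (t _ + t _ + t _); apply/val_inj.
(* The point is determined by its scalar products with [(a, b)] and with the orthogonal vector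
   [(- b, a)]; the latter must be [r / 3 * (t o1 - t o2)] to give the levels [t o1] and [t o2]. *)
pose z1 := (t o0 * a - r / 3 * (t o1 - t o2) * b) / (a ^+ 2 + b ^+ 2).
pose z2 := (t o0 * b + r / 3 * (t o1 - t o2) * a) / (a ^+ 2 + b ^+ 2).
have e0 : a * z1 + b * z2 = t o0 by rewrite /z1 /z2; field.
have e1 : - b * z1 + a * z2 = r / 3 * (t o1 - t o2) by rewrite /z1 /z2; field.
have re1 : r / 2 * (- b * z1 + a * z2) = (t o1 - t o2) / 2.
  rewrite e1; have -> : r / 2 * (r / 3 * (t o1 - t o2)) = r ^+ 2 / 6 * (t o1 - t o2) by field.
  by rewrite r3; field.
exists a, b, z1, z2; split => //.
- exact: (median_formP e0 (ht o0)).
- rewrite /lf1; apply: (@median_formP _ _ (t o1)); last by rewrite -/r -va1 -vb1; exact: ht.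
  by rewrite -/r; lra.
- rewrite /lf2; apply: (@median_formP _ _ (t o2)); last by rewrite -/r -va2 -vb2; exact: ht.
  by rewrite -/r; lra.
Qed.

End medians.

(** * Measure-preserving pairings *)
Section measure_isomorphisms.
Context {R : realType} {d : measure_display} {T : measurableType d}.
Variable mu : {measure set T -> \bar R}.
Implicit Types (A B C E M N V : set T) (f g : T -> T).

Lemma measure_disjU A B : measurable A -> measurable B ->
  (forall x, A x -> B x -> False) -> mu (A `|` B) = (mu A + mu B)%E.
Proof.
move=> mA mB AB; apply: measureU => //.
by apply/seteqP; split => // x [/AB]; exact.
Qed.

Definition bimeasurable A B f g := [/\ measurable A, measurable B,
  forall x, A x -> B (f x) /\ g (f x) = x,
  forall y, B y -> A (g y) /\ f (g y) = y &
  (forall E, measurable E -> measurable (A `&` f @^-1` E)) /\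
  (forall E, measurable E -> measurable (B `&` g @^-1` E))].

Definition measure_iso A B f g := bimeasurable A B f g /\
  forall E, measurable E -> mu (A `&` f @^-1` E) = mu (B `&` E).

Lemma measure_iso_measure A B f g : measure_iso A B f g -> mu A = mu B.
Proof.
by move=> [_ /(_ setT measurableT)]; rewrite preimage_setT !setIT.
Qed.

Lemma measure_iso_sym A B f g : measure_iso A B f g -> measure_iso B A g f.
Proof.
move=> [[mA mB fg gf [mf mg]] muf]; split; first by split.
move=> E mE; have mE' := mg _ mE.
have := muf _ mE'; rewrite setIA setIid => <-; congr (mu _).
apply/seteqP; split => x [Ax /=].
  by move=> [_ /=]; rewrite (fg x Ax).2.
by move=> Ex; split => //; split; rewrite /= ?(fg x Ax).2//; exact: (fg x Ax).1.
Qed.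

Lemma measure_iso_comp A B C f g h k : measure_iso A B f g ->
  measure_iso B C h k -> measure_iso A C (h \o f) (g \o k).
Proof.
move=> [[mA mB fg gf [mf mg]] muf] [[_ mC hk kh [mh mk]] muh].
have e1 E : A `&` (h \o f) @^-1` E = A `&` f @^-1` (B `&` h @^-1` E).
  apply/seteqP; split => x [Ax /=] Ex; split => //; first by split => //; exact: (fg x Ax).1.
  by case: Ex.
have e2 E : C `&` (g \o k) @^-1` E = C `&` k @^-1` (B `&` g @^-1` E).
  apply/seteqP; split => x [Cx /=] Ex; split => //; first by split => //; exact: (kh x Cx).1.
  by case: Ex.
split; first split => //.
- move=> x Ax /=; have [Bfx e] := fg x Ax; split; first exact: (hk _ Bfx).1.
  by rewrite (hk _ Bfx).2.
- move=> x Cx /=; have [Bkx e] := kh x Cx; split; first exact: (gf _ Bkx).1.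
  by rewrite (gf _ Bkx).2.
- by split => E mE; rewrite ?e1 ?e2; [apply/mf/mh|apply/mk/mg].
move=> E mE; rewrite e1 muf; last exact: mh.
by rewrite setIA setIid muh.
Qed.

Lemma measure_iso_restr A B f g V : measure_iso A B f g -> measurable V -> V `<=` A ->
  measure_iso V (B `&` g @^-1` V) f g.
Proof.
move=> [[mA mB fg gf [mf mg]] muf] mV VA; split; first split => //.
- exact: mg.
- by move=> x Vx; have [? e] := fg x (VA _ Vx); split => //; split => //=; rewrite e.
- by move=> y [By Vy]; split => //; exact: (gf _ By).2.
- split => E mE.
    rewrite (_ : V `&` _ = V `&` (A `&` f @^-1` E)); first by apply: measurableI => //; exact: mf.
    by apply/seteqP; split => x; [move=> [Vx ?]; do ?split => //; exact: VA|move=> [? []]].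
  rewrite -setIA (_ : B `&` _ = B `&` g @^-1` (V `&` E)); last by [].
  by apply: mg; exact: measurableI.
move=> E mE.
have mV' := mg _ mV.
rewrite -setIA (setIC (_ @^-1` _)) setIA setIAC -setIA (_ : B `&` _ = B `&` ((B `&` g @^-1` V) `&` E)); last first.
  by rewrite !setIA setIid.
rewrite -muf; last exact: measurableI.
congr (mu _); apply/seteqP; split => x [Ax /=].
  by move=> Ex; have [Bfx e] := fg x (VA _ Ax); split; [exact: VA|do !split => //=; rewrite e].
by move=> [[_ /=]]; rewrite (fg x Ax).2.
Qed.

Definition measure_involution M f := [/\ measurable M,
  forall x, M x -> M (f x) /\ f (f x) = x &
  forall E, measurable E -> measurable (M `&` f @^-1` E) /\
    mu (M `&` f @^-1` E) = mu (M `&` E)].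

(** An isomorphism between disjoint sets and its inverse glue to a map exchanging the two sets. *)
Lemma measure_involution_iso A B f g : measure_iso A B f g ->
  (forall x, A x -> B x -> False) ->
  measure_involution (A `|` B) (fun x => if x \in A then f x else g x).
Proof.
move=> [[mA mB fg gf [mf mg]] muf] AB.
have [_ mug] := measure_iso_sym (conj (And5 mA mB fg gf (conj mf mg)) muf).
have BnA x : B x -> (x \in A) = false by move=> Bx; apply/negP; rewrite inE => /AB; exact.
have AA x : A x -> (x \in A) by move=> Ax; rewrite inE.
split; first exact: measurableU.
  move=> x [Ax|Bx].
    by rewrite (AA _ Ax); have [Bfx e] := fg x Ax; rewrite (BnA _ Bfx); split => //; right.
  by rewrite (BnA _ Bx); have [Agx e] := gf x Bx; rewrite (AA _ Agx); split => //; left.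
move=> E mE; set h := fun x => _.
have -> : (A `|` B) `&` h @^-1` E = (A `&` f @^-1` E) `|` (B `&` g @^-1` E).
  apply/seteqP; split => x.
    by move=> [[Ax|Bx]]; rewrite /h /= ?(AA _ Ax) ?(BnA _ Bx); [left|right].
  by move=> [[Ax]|[Bx]] /=; rewrite /h; split; rewrite /= ?(AA _ Ax) ?(BnA _ Bx)//; [left|right].
split; first by apply: measurableU; [exact: mf|exact: mg].
have dAB (X Y : set T) x : (A `&` X) x -> (B `&` Y) x -> False.
  by move=> [/AB h1 _] [/h1].
rewrite measure_disjU; [|exact: mf|exact: mg|exact: dAB].
rewrite muf// mug// addeC setIUl measure_disjU//; try exact: measurableI.
exact: dAB.
Qed.

Lemma measure_involutionU M N f g : measure_involution M f ->
  measure_involution N g -> (forall x, M x -> N x -> False) ->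
  measure_involution (M `|` N) (fun x => if x \in M then f x else g x).
Proof.
move=> [mM fM muf] [mN gN mug] MN.
have NnM x : N x -> (x \in M) = false by move=> Nx; apply/negP; rewrite inE => /MN; exact.
have MM x : M x -> (x \in M) by move=> Ax; rewrite inE.
split; first exact: measurableU.
  move=> x [Mx|Nx].
    by rewrite (MM _ Mx); have [Mfx e] := fM x Mx; rewrite (MM _ Mfx); split => //; left.
  by rewrite (NnM _ Nx); have [Ngx e] := gN x Nx; rewrite (NnM _ Ngx); split => //; right.
move=> E mE; set h := fun x => _.
have -> : (M `|` N) `&` h @^-1` E = (M `&` f @^-1` E) `|` (N `&` g @^-1` E).
  apply/seteqP; split => x.
    by move=> [[Ax|Bx]]; rewrite /h /= ?(MM _ Ax) ?(NnM _ Bx); [left|right].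
  by move=> [[Ax]|[Bx]] /=; rewrite /h; split; rewrite /= ?(MM _ Ax) ?(NnM _ Bx)//; [left|right].
have [mf ef] := muf _ mE; have [mg eg] := mug _ mE.
split; first exact: measurableU.
have dMN (X Y : set T) x : (M `&` X) x -> (N `&` Y) x -> False.
  by move=> [/MN h1 _] [/h1].
rewrite measure_disjU//; last exact: dMN.
rewrite ef eg setIUl measure_disjU//; try exact: measurableI.
exact: dMN.
Qed.

Variable W : T -> T -> Prop.

(** Null sets are discarded because equal measure yields isomorphisms only up to null sets. *)
Definition matched M := measurable M /\ exists M' f,
  [/\ M' `<=` M, mu (M `\` M') = 0, measure_involution M' f &
      forall x, M' x -> W x (f x)].

Lemma matched_sub M N : matched N -> measurable M -> N `<=` M ->
  mu (M `\` N) = 0 -> matched M.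
Proof.
move=> [mN [N' [f [N'N N0 invf Wf]]]] mM NM MN0; split => //; exists N', f.
have mN' : measurable N' by case: invf.
split => //; first exact: subset_trans NM.
rewrite (_ : M `\` N' = (M `\` N) `|` (N `\` N')).
  by apply: null_set_setU => //; exact: measurableD.
apply/seteqP; split => x.
  by move=> [Mx N'x]; case: (pselect (N x)) => Nx; [right|left].
by move=> [[Mx Nx]|[Nx N'x]]; split => //; [move=> /N'N|exact: NM].
Qed.

Lemma matchedU M N : matched M -> matched N -> (forall x, M x -> N x -> False) ->
  matched (M `|` N).
Proof.
move=> [mM [M' [f [M'M M0 invf Wf]]]] [mN [N' [g [N'N N0 invg Wg]]]] MN.
have mM' : measurable M' by case: invf.
have mN' : measurable N' by case: invg.
have MN' x : M' x -> N' x -> False by move=> /M'M Mx /N'N; exact: MN.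
split; first exact: measurableU.
exists (M' `|` N'), (fun x => if x \in M' then f x else g x); split.
- by move=> x [/M'M|/N'N]; [left|right].
- rewrite (_ : _ `\` _ = (M `\` M') `|` (N `\` N')).
    by apply: null_set_setU => //; exact: measurableD.
  apply/seteqP; split => x.
    by move=> [[Mx|Nx] /not_orP[M'x N'x]]; [left|right].
  move=> [[Mx M'x]|[Nx N'x]]; split; [by left| |by right|] => -[] //.
    by move=> /N'N; exact: MN.
  by move=> /M'M Mx; exact: MN Nx.
- by apply: measure_involutionU.
- move=> x [M'x|N'x]; first by rewrite mem_set//; exact: Wf.
  by rewrite memNset; [exact: Wg|move=> M'x; exact: (MN' x)].
Qed.

Hypothesis Wsym : forall x y, W x y -> W y x.

Lemma matched_iso A B f g : measure_iso A B f g -> (forall x, A x -> B x -> False) ->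
  (forall x, A x -> W x (f x)) -> matched (A `|` B).
Proof.
move=> iso AB Wf; have [[mA mB fg gf _] _] := iso.
split; first exact: measurableU.
exists (A `|` B), (fun x => if x \in A then f x else g x); split => //.
- by rewrite setDv measure0.
- exact: measure_involution_iso.
- move=> x [Ax|Bx]; first by rewrite mem_set//; exact: Wf.
  rewrite memNset; last by move=> /AB; exact.
  have [Agx e] := gf x Bx.
  by apply: Wsym; rewrite -{2}e; exact: Wf.
Qed.

Variable D : set T.
Hypotheses (mD : measurable D) (Doo : (mu D < +oo)%E).

Lemma fin_measure_sub A : measurable A -> A `<=` D -> mu A \is a fin_num.
Proof.
move=> mA AD; rewrite ge0_fin_numE//; apply: le_lt_trans Doo.
by apply: le_measure; rewrite ?inE.
Qed.

Lemma eq_measure_setD0 A B : measurable A -> measurable B -> B `<=` D ->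
  A `<=` B -> mu A = mu B -> mu (B `\` A) = 0.
Proof.
move=> mA mB BD AB e.
have -> : mu (B `\` A) = (mu B - mu (B `&` A))%E.
  by apply: measureD => //; rewrite -ge0_fin_numE// fin_measure_sub.
by rewrite setIidr// e subee// fin_measure_sub.
Qed.

Lemma measure_full A B : measurable A -> measurable B -> A `<=` B ->
  mu (B `\` A) = 0 -> mu A = mu B.
Proof.
move=> mA mB AB e.
have : mu B = (mu (B `\` A) + mu (B `&` A))%E by exact: measureDI.
by rewrite e add0e setIidr// => ->.
Qed.

Hypothesis iso_ex : forall A B, measurable A -> measurable B -> A `<=` D -> B `<=` D ->
  mu A = mu B -> exists A' B' f g, [/\ A' `<=` A, B' `<=` B, mu (A `\` A') = 0,
    mu (B `\` B') = 0 & measure_iso A' B' f g].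

Lemma matched_prod A B : measurable A -> measurable B -> A `<=` D -> B `<=` D ->
  mu A = mu B -> (forall x, A x -> B x -> False) ->
  (forall x y, A x -> B y -> W x y) -> matched (A `|` B).
Proof.
move=> mA mB AD BD eAB AB WAB.
have [A' [B' [f [g [A'A B'B A0 B0 iso]]]]] := iso_ex mA mB AD BD eAB.
have [[mA' mB' fg gf _] _] := iso.
have AB' x : A' x -> B' x -> False by move=> /A'A Ax /B'B; exact: AB.
apply: (@matched_sub _ (A' `|` B')).
- apply: (matched_iso iso) => // x A'x.
  by apply: WAB; [exact: A'A|apply: B'B; exact: (fg x A'x).1].
- exact: measurableU.
- by move=> x [/A'A|/B'B]; [left|right].
rewrite (_ : _ `\` _ = (A `\` A') `|` (B `\` B')).
  by apply: null_set_setU => //; exact: measurableD.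
apply/seteqP; split => x.
  by move=> [[Mx|Nx] /not_orP[M'x N'x]]; [left|right].
move=> [[Mx M'x]|[Nx N'x]]; split; [by left| |by right|] => -[] //.
  by move=> /B'B; exact: AB.
by move=> /A'A Mx; exact: AB Nx.
Qed.

Hypothesis W_measurable : forall A B f g A' f' g', measure_iso A B f g ->
  measure_iso A A' f' g' -> B `<=` D -> A' `<=` D ->
  measurable (A `&` [set x | W (f' x) (f x)]).

(** The two sets are the copies of [V] in [B] and in [C]; the isomorphism between them passes
    through [A]. *)
Lemma matched_pair A B C f g h k V : measure_iso A B f g -> measure_iso A C h k ->
  measurable V -> V `<=` A -> (forall x, B x -> C x -> False) ->
  (forall x, V x -> W (f x) (h x)) ->
  matched ((B `&` g @^-1` V) `|` (C `&` k @^-1` V)).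
Proof.
move=> isoB isoC mV VA BC WV.
have isoBV := measure_iso_sym (measure_iso_restr isoB mV VA).
apply: (matched_iso (measure_iso_comp isoBV (measure_iso_restr isoC mV VA))).
  by move=> x [Bx _] [Cx _]; exact: BC Cx.
move=> x [Bx Vx] /=; have [[_ _ _ gf _] _] := isoB.
by rewrite -{1}(gf x Bx).2; exact: WV.
Qed.

Lemma bigcup4E (F : bool * bool -> set T) :
  \bigcup_i F i = (F (false, false) `|` F (false, true)) `|`
    (F (true, false) `|` F (true, true)).
Proof.
apply/seteqP; split => [x [[[] []] _ Fx]|x [[]|[]] Fx].
- by right; right.
- by right; left.
- by left; right.
- by left; left.
- by exists (false, false).
- by exists (false, true).
- by exists (true, false).
- by exists (true, true).
Qed.

Lemma matched_bigcup4 (F : bool * bool -> set T) : (forall i, matched (F i)) ->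
  (forall i j x, F i x -> F j x -> i = j) -> matched (\bigcup_i F i).
Proof.
move=> mF disj; rewrite bigcup4E; apply: matchedU; [apply: matchedU => //|apply: matchedU => //|].
- by move=> x h1 h2; have := disj _ _ _ h1 h2.
- by move=> x h1 h2; have := disj _ _ _ h1 h2.
- by move=> x [] h1 [] h2; have := disj _ _ _ h1 h2.
Qed.

Lemma null_cover4 (F : bool * bool -> set T) X : measurable X ->
  (forall i, measurable (F i)) -> (forall i, mu (F i) = 0) ->
  X `<=` \bigcup_i F i -> mu X = 0.
Proof.
move=> mX mF F0 XF.
apply: (subset_measure0 _ _ XF) => //; rewrite bigcup4E; first by do 3 apply: measurableU => //.
apply: null_set_setU; by [exact: measurableU|exact: null_set_setU].
Qed.

(* The four sets are indexed by [bool * bool]; the last one, [(true, true)],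
   consists of points that may be paired with anything. *)
Lemma matched_four (E : bool * bool -> set T) :
  (forall i, measurable (E i)) -> (forall i, E i `<=` D) ->
  (forall i, mu (E (false, false)) = mu (E i)) ->
  (forall i j x, E i x -> E j x -> i = j) ->
  (forall x y w, E (false, false) x -> E (false, true) y -> E (true, false) w ->
     [\/ W x y, W x w | W y w]) ->
  (forall x y, D x -> E (true, true) y -> W x y) ->
  matched (\bigcup_i E i).
Proof.
move=> mE ED muE Edisj W3 Wc; pose o : bool * bool := (false, false).
(* Each [E i], the first one included, is parametrized by a subset [A' i] of full measure in [E o].
   Over the intersection [A] all four sets become copies [C i] of one base. *)
have /choice[A' /choice[B' /choice[f /choice[g hp]]]] :=
  fun i => iso_ex (mE o) (mE i) (@ED o) (@ED i) (muE i).
pose A := \bigcap_i A' i.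
have mA' i : measurable (A' i) by have [_ _ _ _ [[]]] := hp i.
have mA : measurable A by apply: fin_bigcap_measurable => // i _.
have AE : A `<=` E o by move=> x /(_ o I); have [+ _ _ _ _] := hp o; exact.
have muA : mu A = mu (E o).
  apply: measure_full => //.
  apply: (@null_cover4 (fun i => E o `\` A' i)); [exact: measurableD| | |].
  - by move=> i; exact: measurableD.
  - by move=> i; have [] := hp i.
  - move=> x [Ex nAx]; apply: contrapT => h; apply: nAx => i _.
    by apply: contrapT => nA'x; apply: h; exists i.
pose C i := B' i `&` g i @^-1` A.
have iso i : measure_iso A (C i) (f i) (g i).
  by have [_ _ _ _ isoi] := hp i; apply: (measure_iso_restr isoi) => // x; exact.
have CE i : C i `<=` E i by move=> x [+ _]; have [_ + _ _ _] := hp i; exact.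
have mC i : measurable (C i) by have [[]] := iso i.
have Cnull i : mu (E i `\` C i) = 0.
  apply: eq_measure_setD0; [exact: mC|exact: mE|exact: ED|exact: CE|].
  by rewrite -(measure_iso_measure (iso i)) muA.
(* The part of the four copies that lies over [V]. *)
pose N V := \bigcup_i (C i `&` g i @^-1` V).
have matchN V i j k l : measurable V -> V `<=` A ->
    (forall m, [\/ m = i, m = j | m = k \/ m = l]) -> uniq [:: i; j; k; l] ->
    (forall x, V x -> W (f i x) (f j x)) -> (forall x, V x -> W (f k x) (f l x)) ->
    matched (N V).
  move=> mV VA all_ijkl u Wij Wkl.
  have disj i1 j1 : i1 != j1 -> forall x, C i1 x -> C j1 x -> False.
    by move=> /eqP ij x /CE Ex /CE Ey; apply: ij; exact: Edisj Ex Ey.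
  move: u; rewrite /= !inE !negb_or andbT => /and3P[/and3P[ij ik il] /andP[jk jl] kl].
  have -> : N V = ((C i `&` g i @^-1` V) `|` (C j `&` g j @^-1` V)) `|`
      ((C k `&` g k @^-1` V) `|` (C l `&` g l @^-1` V)).
    apply/seteqP; split => x.
      move=> [m _]; case: (all_ijkl m) => [->|->|[->|->]] ?.
      by left; left. by left; right. by right; left. by right; right.
    by move=> [[]|[]] ?; [exists i|exists j|exists k|exists l].
  apply: matchedU.
  - by apply: (matched_pair (iso i) (iso j)) => //; exact: disj.
  - by apply: (matched_pair (iso k) (iso l)) => //; exact: disj.
  - by move=> x [[Ci _]|[Cj _]] [[Ck _]|[Cl _]];
      [apply: (disj i k)|apply: (disj i l)|apply: (disj j k)|apply: (disj j l)]; eauto.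
pose i1 : bool * bool := (false, true); pose i2 : bool * bool := (true, false).
pose i3 : bool * bool := (true, true).
have CD i : C i `<=` D by apply: (subset_trans (@CE i)); exact: ED.
have mW i j : measurable (A `&` [set x | W (f i x) (f j x)]).
  exact: (W_measurable (iso j) (iso i)).
(* The base is split according to which two of the first three copies are paired; the third of them
   is then paired with the fourth copy. Off [V1] and [V2], [W3] leaves only the pair [i1], [i2]. *)
pose V1 := A `&` [set x | W (f o x) (f i1 x)].
pose V2 := (A `&` [set x | W (f o x) (f i2 x)]) `\` V1.
pose V3 := (A `\` V1) `\` V2.
have mV1 : measurable V1 by exact: mW.
have mV2 : measurable V2 by apply: measurableD.
have mV3 : measurable V3 by apply: measurableD => //; exact: measurableD.
have Cf i x : A x -> C i (f i x) by have [[_ _ fg _ _] _] := iso i; move=> /fg[].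
have Wc3 i x : A x -> W (f i x) (f i3 x).
  by move=> Ax; apply: Wc; [apply: CD|apply: CE]; exact: Cf.
have M1 : matched (N V1).
  apply: (matchN V1 o i1 i2 i3) => //; [by move=> x []| |by move=> x []|by move=> x [/Wc3]].
  by move=> [[] []]; [apply: Or33; right|apply: Or33; left|apply: Or32|apply: Or31].
have M2 : matched (N V2).
  apply: (matchN V2 o i2 i1 i3) => //; [by move=> x [[]]| |by move=> x [[]]|by move=> x [[/Wc3]]].
  by move=> [[] []]; [apply: Or33; right|apply: Or32|apply: Or33; left|apply: Or31].
have M3 : matched (N V3).
  apply: (matchN V3 i1 i2 o i3) => //; [by move=> x [[]]| | |by move=> x [[/Wc3]]].
    by move=> [[] []]; [apply: Or33; right|apply: Or32|apply: Or31|apply: Or33; left].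
  move=> x [[Ax nV1] nV2].
  have := W3 _ _ _ (CE _ _ (Cf o x Ax)) (CE _ _ (Cf i1 x Ax)) (CE _ _ (Cf i2 x Ax)).
  by case=> // w; [case: nV1|case: nV2].
have Ndisj V V' : (forall x, V x -> V' x -> False) -> forall x, N V x -> N V' x -> False.
  move=> VV x [i _ [Cx Vx]] [j _ [Cy Vy]].
  by apply: (VV (g i x)) => //; rewrite (Edisj i j x) //; exact: CE.
have M123 : matched (N V1 `|` N V2 `|` N V3).
  apply: matchedU => //; first by apply: matchedU => //; apply: Ndisj => x ? [].
  by move=> x [] N1; apply: Ndisj N1 => y ? [[]].
apply: (matched_sub M123).
- exact: fin_bigcup_measurable.
- by move=> x [[]|] [i _ [/CE Ex _]]; exists i.
apply: (@null_cover4 (fun i => E i `\` C i)) => //.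
- by apply: measurableD; [exact: fin_bigcup_measurable|case: M123].
- by move=> i; exact: measurableD.
move=> x [[i _ Ex] nN]; exists i => //; split => // Cx; apply: nN.
have [[_ _ _ gf _] _] := iso i; have [Ag _] := gf x Cx.
case: (pselect (V1 (g i x))) => h1; first by left; left; exists i.
case: (pselect (V2 (g i x))) => h2; first by left; right; exists i.
by right; exists i.
Qed.

Hypothesis sub_ex : forall A V, measurable A -> measurable V -> A `<=` D ->
  V `<=` D -> (mu A <= mu V)%E -> exists V', [/\ measurable V', V' `<=` V & mu V' = mu A].

(** A part [P' i] with the mass of [N i] is cut out of [P i] and paired with [N i]. The four
    remainders all have mass [c], and [matched_four] pairs them among themselves. *)
Lemma matched_eight (P N : bool * bool -> set T) (c : R) :
  (forall i, measurable (P i)) -> (forall i, measurable (N i)) ->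
  (forall i, P i `<=` D) -> (forall i, N i `<=` D) ->
  (forall i j x, P i x -> P j x -> i = j) ->
  (forall i j x, N i x -> N j x -> i = j) ->
  (forall i j x, P i x -> N j x -> False) ->
  0 <= c -> (forall i, fine (mu (P i)) = fine (mu (N i)) + c) ->
  (forall i x y, P i x -> N i y -> W x y) ->
  (forall x y w, P (false, false) x -> P (false, true) y -> P (true, false) w ->
     [\/ W x y, W x w | W y w]) ->
  (forall x y, D x -> P (true, true) y -> W x y) ->
  matched (\bigcup_i P i `|` \bigcup_i N i).
Proof.
move=> mP mN PD ND disjP disjN disjPN c0 muP WPN W3 Wc.
have finP i : mu (P i) \is a fin_num by apply: fin_measure_sub.
have finN i : mu (N i) \is a fin_num by apply: fin_measure_sub.
have eP i : mu (P i) = (mu (N i) + c%:E)%E.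
  by rewrite -(fineK (finP i)) -(fineK (finN i)) -EFinD muP.
have NP i : (mu (N i) <= mu (P i))%E by rewrite eP leeDl.
have /choice[P' hP'] := fun i => sub_ex (mN i) (mP i) (@ND i) (@PD i) (NP i).
have mP' i : measurable (P' i) by have [] := hP' i.
have P'P i : P' i `<=` P i by have [] := hP' i.
have eP' i : mu (P' i) = mu (N i) by have [] := hP' i.
pose E i := P i `\` P' i.
have EP i : E i `<=` P i by move=> x [].
have muE i : mu (E i) = c%:E.
  have -> : mu (E i) = (mu (P i) - mu (P i `&` P' i))%E.
    by apply: measureD => //; rewrite -ge0_fin_numE// finP.
  by rewrite setIidr// eP' eP addeAC subee// add0e.
have ME : matched (\bigcup_i E i).
  apply: matched_four.
  - by move=> i; exact: measurableD.
  - by move=> i x /EP; exact: PD.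
  - by move=> i; rewrite !muE.
  - by move=> i j x /EP + /EP; exact: disjP.
  - by move=> x y w /EP + /EP + /EP; exact: W3.
  - by move=> x y Dx /EP; exact: Wc.
have MP : matched (\bigcup_i (P' i `|` N i)).
  apply: matched_bigcup4 => [i|i j x].
    apply: matched_prod => //.
    - exact: subset_trans (@PD i).
    - by move=> x /P'P; exact: disjPN.
    - by move=> x y /P'P; exact: WPN.
  by move=> [/P'P|] h1 [/P'P|] h2; [exact: disjP h1 h2|case: (disjPN _ _ _ h1 h2)
    |case: (disjPN _ _ _ h2 h1)|exact: disjN h1 h2].
suff -> : \bigcup_i P i `|` \bigcup_i N i = \bigcup_i E i `|` \bigcup_i (P' i `|` N i).
  apply: matchedU => // x [i _ [Px P'x]] [j _ [P'x'|Nx]].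
    by apply: P'x; rewrite (disjP i j x Px (P'P _ _ P'x')).
  exact: disjPN Px Nx.
apply/seteqP; split => x.
  move=> [[i _ Px]|[i _ Nx]]; last by right; exists i => //; right.
  by case: (pselect (P' i x)) => P'x; [right; exists i => //; left|left; exists i].
move=> [[i _ [Px _]]|[i _ [/P'P Px|Nx]]]; by [left; exists i|right; exists i].
Qed.

End measure_isomorphisms.

(** * From three halving lines to an involution with wide pairs *)

Section wide_involution.
Context {R : realType} {d : measure_display} {T : measurableType d}.
Variables (mu : {measure set T -> \bar R}) (D : set T).
Hypotheses (mD : measurable D) (muD : mu D = 1%E).
Hypothesis iso_ex : forall A B, measurable A -> measurable B -> A `<=` D -> B `<=` D ->
  mu A = mu B -> exists A' B' f g, [/\ A' `<=` A, B' `<=` B, mu (A `\` A') = 0,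
    mu (B `\` B') = 0 & measure_iso mu A' B' f g].
Hypothesis sub_ex : forall A V, measurable A -> measurable V -> A `<=` D ->
  V `<=` D -> (mu A <= mu V)%E -> exists V', [/\ measurable V', V' `<=` V & mu V' = mu A].
Hypothesis half_ex : forall U V, measurable U -> measurable V -> U `<=` V ->
  V `<=` D -> (mu U <= (1 / 2)%:E <= mu V)%E ->
  exists H, [/\ measurable H, U `<=` H, H `<=` V & mu H = (1 / 2)%:E].
Variable g : T -> R[i].
Hypothesis mg : cmeas D g.

Lemma measurable_fun_iso (A B : set T) f k (u : T -> R) : measure_iso mu A B f k ->
  B `<=` D -> measurable_fun D u -> measurable_fun A (u \o f).
Proof.
move=> [[mA mB fk _ [mf _]] _] BD mu_ _ Y mY.
rewrite (_ : A `&` _ = A `&` f @^-1` (D `&` u @^-1` Y)).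
  by apply: mf; exact: mu_.
apply/seteqP; split => x [Ax] /=; last by move=> [_ ?]; split.
by move=> Yx; split => //; split => //; apply: BD; exact: (fk x Ax).1.
Qed.

Lemma measurable_fun_norm2 (A : set T) (u v : T -> R) : measurable_fun A u ->
  measurable_fun A v -> measurable_fun A (fun x => norm2 (u x) (v x)).
Proof.
move=> mu_ mv.
apply: (@measurableT_comp _ _ _ _ _ _ (fun x : R => Num.sqrt x)).
  by apply: continuous_measurable_fun; exact: sqrt_continuous.
by apply: measurable_funD; apply: measurable_funX.
Qed.

Lemma wide_measurable z (A B : set T) f k (A' : set T) f' k' : measure_iso mu A B f k ->
  measure_iso mu A A' f' k' -> B `<=` D -> A' `<=` D ->
  measurable (A `&` [set x | wide z (g (f' x)) (g (f x))]).
Proof.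
move=> iso iso' BD A'D; case: (mg) => mg1 mg2.
have m1 := measurable_fun_iso iso BD mg1; have m2 := measurable_fun_iso iso BD mg2.
have m1' := measurable_fun_iso iso' A'D mg1; have m2' := measurable_fun_iso iso' A'D mg2.
have mA : measurable A by case: iso => -[].
have ReB (p q : R[i]) : complex.Re (p - q) = complex.Re p - complex.Re q by case: p q => [? ?] [].
have ImB (p q : R[i]) : complex.Im (p - q) = complex.Im p - complex.Im q by case: p q => [? ?] [].
have /(_ mA [set true]) : measurable_fun A (fun x => wide z (g (f' x)) (g (f x))).
  apply: measurable_fun_ler.
    apply: measurable_funM => //.
    by apply: measurable_funD; under eq_fun do rewrite cabsE ReB ImB;
      apply: measurable_fun_norm2; exact: measurable_funB.
  under eq_fun do rewrite cabsE ReB ImB.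
  by apply: measurable_fun_norm2; exact: measurable_funB.
exact.
Qed.

Let Doo : (mu D < +oo)%E. Proof. by rewrite muD ltry. Qed.

Let m A := fine (mu A).

Lemma fine_measureU A B : measurable A -> measurable B -> A `<=` D -> B `<=` D ->
  (forall x, A x -> B x -> False) -> m (A `|` B) = m A + m B.
Proof.
move=> mA mB AD BD AB; rewrite /m (measure_disjU mu)// fineD//;
exact: (fin_measure_sub mD Doo).
Qed.

(** [half_ex] inserts an exact half between [l > 0] and [l >= 0], which distributes the mass on the
    line [l = 0] over the two sides. *)
Lemma median_form_half (l : T -> R) : measurable_fun D l -> median_form mu D l ->
  exists H, [/\ measurable H, H `<=` D, mu H = (1 / 2)%:E,
    forall x, H x -> 0 <= l x & forall x, D x -> ~ H x -> l x <= 0].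
Proof.
move=> ml [pos neg].
have m1 : measurable (D `&` [set x | 0 < l x]).
  rewrite (_ : [set x | _] = l @^-1` `]0, +oo[); first exact: ml.
  by apply/seteqP; split => x /=; rewrite in_itv/= andbT.
have m2 : measurable (D `&` [set x | l x < 0]).
  rewrite (_ : [set x | l x < 0] = l @^-1` `]-oo, 0[); first exact: ml.
  by apply/seteqP; split => x /=; rewrite in_itv/=.
have m3 : measurable (D `\` (D `&` [set x | l x < 0])) by exact: measurableD.
have hV : ((1 / 2)%:E <= mu (D `\` (D `&` [set x | (l x < 0)%R])))%E.
  have -> : mu (D `\` (D `&` [set x | (l x < 0)%R])) =
      (mu D - mu (D `&` (D `&` [set x | (l x < 0)%R])))%E.
    by apply: measureD => //; exact: Doo.
  rewrite setIA setIid muD leeBrDr; last exact: (fin_measure_sub mD Doo).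
  apply: le_trans (leeD2l _ neg) _.
  by rewrite -EFinD lee_fin; lra.
have UV : D `&` [set x | 0 < l x] `<=` D `\` (D `&` [set x | l x < 0]).
  by move=> x [Dx /= lx]; split => // -[_ /= h]; move: (lt_trans lx h); rewrite ltxx.
have [H [mH UH HV muH]] := half_ex m1 m3 UV (@subDsetl _ _ _) (introT andP (conj pos hV)).
exists H; split => //.
- by move=> x /HV[].
- move=> x /HV[Dx nx]; rewrite leNgt; apply/negP => lx; exact: nx.
- by move=> x Dx nH; rewrite leNgt; apply/negP => lx; apply: nH; apply: UH.
Qed.

(** Beyond its total mass 1, the space enters only through [iso_ex], [sub_ex] and [half_ex], so that
    one argument serves both the unit interval and finite spaces with an even number of points. *)
Theorem exists_wide_involution : exists z M f, [/\ M `<=` D, mu (D `\` M) = 0,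
  measure_involution mu M f & forall x, M x -> wide z (g x) (g (f x))].
Proof.
case: (mg) => mg1 mg2.
have [a [b [z1 [z2 [ab med0 med1 med2]]]]] := concurrent_medians mD muD mg1 mg2.
pose z := Complex z1 z2.
pose l0 x := lf0 a b (complex.Re (g x) - z1) (complex.Im (g x) - z2).
pose l1 x := lf1 a b (complex.Re (g x) - z1) (complex.Im (g x) - z2).
pose l2 x := lf2 a b (complex.Re (g x) - z1) (complex.Im (g x) - z2).
have mlin c1 c2 : measurable_fun D (fun x => c1 * (complex.Re (g x) - z1) + c2 * (complex.Im (g x) - z2)).
  by apply: measurable_funD; apply: measurable_funM => //; exact: measurable_funB.
have [H0 [mH0 H0D muH0 H0p H0n]] : exists H, [/\ measurable H, H `<=` D, mu H = (1 / 2)%:E,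
    forall x, H x -> 0 <= l0 x & forall x, D x -> ~ H x -> l0 x <= 0].
  by apply: median_form_half => //; exact: mlin.
have [H1 [mH1 H1D muH1 H1p H1n]] : exists H, [/\ measurable H, H `<=` D, mu H = (1 / 2)%:E,
    forall x, H x -> 0 <= l1 x & forall x, D x -> ~ H x -> l1 x <= 0].
  by apply: median_form_half => //; exact: mlin.
have [H2 [mH2 H2D muH2 H2p H2n]] : exists H, [/\ measurable H, H `<=` D, mu H = (1 / 2)%:E,
    forall x, H x -> 0 <= l2 x & forall x, D x -> ~ H x -> l2 x <= 0].
  by apply: median_form_half => //; exact: mlin.
have sum0 x : l0 x + l1 x + l2 x = 0 by exact: lf_sum0.
have ReB x : complex.Re (g x - z) = complex.Re (g x) - z1 by case: (g x).
have ImB x : complex.Im (g x - z) = complex.Im (g x) - z2 by case: (g x).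
(* Pieces are indexed by membership in the chosen halves and not by strict signs of the forms; on
   each piece the signs are then only weak. *)
pose X (s : bool * bool * bool) := D `&` [set x | (x \in H0, x \in H1, x \in H2) = s].
have mX s : measurable (X s).
  have mH (H : set T) b' : measurable H -> measurable (D `&` [set x | (x \in H) = b']).
    move=> mH; case: b'.
      rewrite (_ : [set x | _] = H); first exact: measurableI.
      by apply/seteqP; split => x /=; [move/set_mem|move/mem_set].
    rewrite (_ : [set x | _] = ~` H); first by apply: measurableI => //; exact: measurableC.
    by apply/seteqP; split => x /=; [move=> e Hx; move: e; rewrite mem_set|move=> nH; rewrite memNset].
  case: s => -[s0 s1] s2.
  rewrite (_ : X _ = (D `&` [set x | (x \in H0) = s0]) `&` (D `&` [set x | (x \in H1) = s1])
     `&` (D `&` [set x | (x \in H2) = s2])); first by apply: measurableI; [apply: measurableI|]; exact: mH.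
  apply/seteqP; split => x; first by move=> [Dx [e0 e1 e2]]; do !split.
  by move=> [[[Dx /= e1] [_ /= e2]] [_ /= e3]]; split => //=; rewrite e1 e2 e3.
have XD s : X s `<=` D by move=> x [].
have Xinj s s' x : X s x -> X s' x -> s = s' by move=> [_ /= <-] [_ /= <-].
have sg s0 s1 s2 x : X (s0, s1, s2) x ->
    [/\ if s0 then 0 <= l0 x else l0 x <= 0, if s1 then 0 <= l1 x else l1 x <= 0
      & if s2 then 0 <= l2 x else l2 x <= 0].
  move=> [Dx [<- <- <-]]; split; case: ifPn.
  - by rewrite inE => /H0p.
  - by rewrite notin_setE => /(H0n _ Dx).
  - by rewrite inE => /H1p.
  - by rewrite notin_setE => /(H1n _ Dx).
  - by rewrite inE => /H2p.
  - by rewrite notin_setE => /(H2n _ Dx).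
pose W x y := wide z (g x) (g y).
have Wopp x y : l0 x * l0 y <= 0 -> l1 x * l1 y <= 0 -> l2 x * l2 y <= 0 -> W x y.
  move=> h0 h1 h2; apply: wide_obtuse; rewrite /obtuse !ReB !ImB.
  exact: (lf_opposite_obtuse ab).
(* [sP] lists three alternate sectors and the piece (+++), [sN] the opposite pieces in the same
   order. *)
pose sP (i : bool * bool) : bool * bool * bool := match i with
  | (false, false) => (true, false, false) | (false, true) => (false, true, false)
  | (true, false) => (false, false, true) | (true, true) => (true, true, true) end.
pose sN i := let: (s0, s1, s2) := sP i in (~~ s0, ~~ s1, ~~ s2).
have Hsum (H : set T) (F : bool * bool -> set T) : mu H = (1 / 2)%:E -> H = \bigcup_i F i ->
    (forall i, measurable (F i)) -> (forall i, F i `<=` D) ->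
    (forall i j x, F i x -> F j x -> i = j) ->
    m (F (false, false)) + m (F (false, true)) + (m (F (true, false)) + m (F (true, true))) = 1 / 2.
  move=> muH HF mF FD Fdisj.
  have <- : m H = 1 / 2 by rewrite /m muH.
  rewrite HF bigcup4E !fine_measureU //; try by [exact: measurableU
    |move=> x h1 h2; have := Fdisj _ _ _ h1 h2|move=> x []; exact: FD].
  by move=> x [] h1 [] h2; have := Fdisj _ _ _ h1 h2.
pose q s := m (X s).
have Hset (H : set T) (F : bool * bool -> bool * bool * bool) : H `<=` D ->
    (forall x, D x -> H x <-> exists i, (x \in H0, x \in H1, x \in H2) = F i) ->
    H = \bigcup_i X (F i).
  move=> HD hF; apply/seteqP; split => x.
    by move=> Hx; have /(hF _ (HD _ Hx))[i e] := Hx; exists i => //; split => //; exact: HD.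
  by move=> [i _ [Dx e]]; apply/(hF _ Dx); exists i.
have hH (k : bool * bool * bool -> bool) (F : bool * bool -> bool * bool * bool) H :
    H `<=` D -> mu H = (1 / 2)%:E -> injective F -> (forall s, k s <-> exists i, s = F i) ->
    (forall x, D x -> (x \in H) = k (x \in H0, x \in H1, x \in H2)) ->
    q (F (false, false)) + q (F (false, true)) + (q (F (true, false)) + q (F (true, true))) = 1 / 2.
  move=> HD muH Finj kF Hk; apply: (Hsum H (fun i => X (F i)) muH).
  - by apply: Hset => // x Dx; rewrite -kF -Hk // inE.
  - by move=> i; exact: mX.
  - by move=> i; exact: XD.
  - by move=> i j x h1 h2; apply: Finj; exact: Xinj h1 h2.
have hDC H : measurable H -> H `<=` D -> mu H = (1 / 2)%:E -> mu (D `\` H) = (1 / 2)%:E.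
  move=> mH HD muH; have -> : mu (D `\` H) = (mu D - mu (D `&` H))%E.
    by apply: measureD => //; exact: Doo.
  by rewrite setIidr// muH muD -EFinB; congr EFin; lra.
have cE x H : D x -> (x \in D `\` H) = ~~ (x \in H).
  move=> Dx; case: (pselect (H x)) => Hx; first by rewrite (mem_set Hx) memNset//; case.
  by rewrite (memNset Hx) mem_set.
have e0 : q (true, false, false) + q (true, false, true) +
    (q (true, true, false) + q (true, true, true)) = 1 / 2.
  apply: (hH (fun s => s.1.1) (fun i => (true, i.1, i.2)) H0 H0D muH0) => //.
    by move=> [? ?] [? ?] [-> ->].
  move=> [[s0 s1] s2] /=; split => [->|[i [-> _ _]]//]; by exists (s1, s2).
have e0' : q (false, false, false) + q (false, false, true) +
    (q (false, true, false) + q (false, true, true)) = 1 / 2.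
  apply: (hH (fun s => ~~ s.1.1) (fun i => (false, i.1, i.2)) _ _ (hDC _ mH0 H0D muH0)).
  - exact: subDsetl.
  - by move=> [? ?] [? ?] [-> ->].
  - move=> [[s0 s1] s2] /=; split => [/negbTE->|[i [-> _ _]]//]; by exists (s1, s2).
  - by move=> x Dx; rewrite cE.
have e1 : q (false, true, false) + q (false, true, true) +
    (q (true, true, false) + q (true, true, true)) = 1 / 2.
  apply: (hH (fun s => s.1.2) (fun i => (i.1, true, i.2)) H1 H1D muH1) => //.
    by move=> [? ?] [? ?] [-> ->].
  move=> [[s0 s1] s2] /=; split => [->|[i [_ -> _]]//]; by exists (s0, s2).
have e1' : q (false, false, false) + q (false, false, true) +
    (q (true, false, false) + q (true, false, true)) = 1 / 2.
  apply: (hH (fun s => ~~ s.1.2) (fun i => (i.1, false, i.2)) _ _ (hDC _ mH1 H1D muH1)).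
  - exact: subDsetl.
  - by move=> [? ?] [? ?] [-> ->].
  - move=> [[s0 s1] s2] /=; split => [/negbTE->|[i [_ -> _]]//]; by exists (s0, s2).
  - by move=> x Dx; rewrite cE.
have e2 : q (false, false, true) + q (false, true, true) +
    (q (true, false, true) + q (true, true, true)) = 1 / 2.
  apply: (hH (fun s => s.2) (fun i => (i.1, i.2, true)) H2 H2D muH2) => //.
    by move=> [? ?] [? ?] [-> ->].
  move=> [[s0 s1] s2] /=; split => [->|[i [_ _ ->]]//]; by exists (s0, s1).
have e2' : q (false, false, false) + q (false, true, false) +
    (q (true, false, false) + q (true, true, false)) = 1 / 2.
  apply: (hH (fun s => ~~ s.2) (fun i => (i.1, i.2, false)) _ _ (hDC _ mH2 H2D muH2)).
  - exact: subDsetl.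
  - by move=> [? ?] [? ?] [-> ->].
  - move=> [[s0 s1] s2] /=; split => [/negbTE->|[i [_ _ ->]]//]; by exists (s0, s1).
  - by move=> x Dx; rewrite cE.
(* The six equations say that each half and each complement has mass 1/2. Subtracting them in pairs
   leaves one common excess for all opposite pieces. *)
have {e0 e0' e1 e1' e2 e2'} eqs i : q (sP i) = q (sN i) + (q (true, true, true) - q (false, false, false)).
  move: e0 e0' e1 e1' e2 e2'; clear.
  by case: i => [[] []] /=; move: q => q; lra.
(* The family with two plus signs reduces to the one with a single plus sign by replacing [(a, b)]
   with its negative, which negates the three forms. *)
have alt (sgn : bool) x y w : X (sgn, ~~ sgn, ~~ sgn) x -> X (~~ sgn, sgn, ~~ sgn) y ->
    X (~~ sgn, ~~ sgn, sgn) w -> [\/ W x y, W x w | W y w].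
  have wide3 a' b' : (a' != 0) || (b' != 0) ->
      lf1 a' b' (complex.Re (g x) - z1) (complex.Im (g x) - z2) <= 0 ->
      lf2 a' b' (complex.Re (g x) - z1) (complex.Im (g x) - z2) <= 0 ->
      lf0 a' b' (complex.Re (g y) - z1) (complex.Im (g y) - z2) <= 0 ->
      lf2 a' b' (complex.Re (g y) - z1) (complex.Im (g y) - z2) <= 0 ->
      lf0 a' b' (complex.Re (g w) - z1) (complex.Im (g w) - z2) <= 0 ->
      lf1 a' b' (complex.Re (g w) - z1) (complex.Im (g w) - z2) <= 0 ->
      [\/ W x y, W x w | W y w].
    move=> ab' h1 h2 h3 h4 h5 h6.
    have := lf_alternate_obtuse ab' h1 h2 h3 h4 h5 h6.
    by case=> h; [apply: Or31|apply: Or32|apply: Or33]; apply: wide_obtuse; rewrite !ReB !ImB.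
  move=> /sg[x0 x1 x2] /sg[y0 y1 y2] /sg[w0 w1 w2].
  case: sgn x0 x1 x2 y0 y1 y2 w0 w1 w2 => /= x0 x1 x2 y0 y1 y2 w0 w1 w2.
    exact: (wide3 a b).
  have N0 u v : lf0 (- a) (- b) u v = - lf0 a b u v by rewrite /lf0; ring.
  have N1 u v : lf1 (- a) (- b) u v = - lf1 a b u v by rewrite /lf1; field.
  have N2 u v : lf2 (- a) (- b) u v = - lf2 a b u v by rewrite /lf2; field.
  by apply: (wide3 (- a) (- b)); rewrite ?oppr_eq0 // ?N0 ?N1 ?N2 oppr_le0.
have Wsym x y : W x y -> W y x by rewrite /W wide_sym.
have Wmeas := wide_measurable z.
(* Three numbers of the same weak sign with sum 0 all vanish, so the sign condition holds against
   every point. *)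
have Wc x y : D x -> X (true, true, true) y \/ X (false, false, false) y -> W x y.
  move=> Dx h; suff [h0 h1 h2] : [/\ l0 y = 0, l1 y = 0 & l2 y = 0].
    by apply: Wopp; rewrite ?h0 ?h1 ?h2 mulr0.
  by case: h => /sg[]; have := sum0 y; split; lra.
have WPN i x y : X (sP i) x -> X (sN i) y -> W x y.
  case: i => [[] []] /= /sg[x0 x1 x2] /sg[y0 y1 y2]; apply: Wopp;
    by [exact: mulr_ge0_le0|exact: mulr_le0_ge0].
have sPinj : injective sP by move=> [[] []] [[] []].
have sNinj : injective sN by move=> [[] []] [[] []].
have sPN i j : sP i <> sN j by case: i j => [[] []] [[] []].
have cover : \bigcup_i X (sP i) `|` \bigcup_i X (sN i) = D.
  apply/seteqP; split => [x [] [i _ /XD]//|x Dx].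
  case e : (x \in H0, x \in H1, x \in H2) => [[[] []] []].
  - by left; exists (true, true).
  - by right; exists (true, false).
  - by right; exists (false, true).
  - by left; exists (false, false).
  - by right; exists (false, false).
  - by left; exists (false, true).
  - by left; exists (true, false).
  - by right; exists (true, true).
suff [_ [M [f [MD M0 invf Wf]]]] : matched mu W D by exists z, M, f.
(* The sign of the excess decides which of the two families is the heavier one. *)
have [c0|c0] := leP 0 (q (true, true, true) - q (false, false, false)).
  rewrite -cover; apply: (matched_eight Wsym mD Doo iso_ex Wmeas sub_ex
    (P := fun i => X (sP i)) (N := fun i => X (sN i))
    (c := q (true, true, true) - q (false, false, false))) => //.
  - by move=> i j x h1 h2; apply: sPinj; exact: Xinj h1 h2.
  - by move=> i j x h1 h2; apply: sNinj; exact: Xinj h1 h2.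
  - by move=> i j x h1 h2; apply: (sPN i j); exact: Xinj h1 h2.
  - by move=> x y w; exact: (alt true).
  - by move=> x y Dx h; apply: Wc => //; left.
rewrite -cover setUC; apply: (matched_eight Wsym mD Doo iso_ex Wmeas sub_ex
    (P := fun i => X (sN i)) (N := fun i => X (sP i))
    (c := q (false, false, false) - q (true, true, true))) => //.
- by move=> i j x h1 h2; apply: sNinj; exact: Xinj h1 h2.
- by move=> i j x h1 h2; apply: sPinj; exact: Xinj h1 h2.
- by move=> i j x h1 h2; apply: (sPN j i); exact: Xinj h2 h1.
- by rewrite subr_ge0 ltW// -subr_lt0.
- by move=> i; have := eqs i; rewrite /q /m => ->; rewrite -addrA subrKA subrr addr0.
- by move=> i x y h1 h2; apply: Wsym; exact: WPN h2 h1.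
- by move=> x y w; exact: (alt false).
- by move=> x y Dx h; apply: Wc => //; right.
Qed.

End wide_involution.

(** * Exchanging Lebesgue measurable sets *)
Section lebesgue_translation.
Context {R : realType}.

(** The real line with the Lebesgue sigma-algebra; measurability here unfolds to the splitting
    condition of Caratheodory for the outer measure. *)
Definition lebesgueType := caratheodory_type ((wlength (@idfun R))^*)%mu.
Local Notation LT := lebesgueType.
Definition lam : {measure set LT -> \bar R} := @mu_inf R.

(** This is the translate by [- c], a preimage and not an image. *)
Definition shift (c : R) (X : set R) : set R := [set x | X (x + c)].

Lemma shift_itv c (a b : R) : shift c `]a, b] = `]a - c, b - c]%classic.
Proof. by apply/seteqP; split => x; rewrite /shift /= !in_itv/= => /andP[? ?]; lra. Qed.

Lemma shiftK c X : shift (- c) (shift c X) = X.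
Proof. by apply/seteqP; split => x; rewrite /shift /= subrK. Qed.

(** On arbitrary sets [lam] is the outer measure, an infimum over covers by half-open intervals, and
    translating a cover preserves its total length. *)
Lemma le_lam_shift c (X : set LT) : (lam (shift c X) <= lam X)%E.
Proof.
apply: le_ereal_inf_tmp => _ [F [mF XF] <-].
apply: ereal_inf_lbound; exists (fun k => shift c (F k)).
  split=> [k|x /XF[k _ Fk]]; last by exists k.
  by case: (mF k) => -[a b] _ <-; rewrite shift_itv; exact: is_ocitv.
apply: eq_eseriesr => k _; case: (mF k) => -[a b] _ <- /=.
rewrite shift_itv !wlength_itv /= !lte_fin ltrD2r; case: ifPn => // _.
by rewrite -!EFinD; congr EFin; rewrite /=; lra.
Qed.

Lemma lam_shift c (X : set LT) : lam (shift c X) = lam X.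
Proof.
apply/eqP; rewrite eq_le le_lam_shift /=.
by rewrite -{1}(shiftK c X); exact: le_lam_shift.
Qed.

(** Splitting [Y] by the translate of [X] amounts to splitting the inversely translated [Y] by
    [X]. *)
Lemma measurable_shift c (X : set LT) : measurable X -> measurable (shift c X : set LT).
Proof.
have cara (A : set LT) : measurable A =
    (forall Y : set R, lam Y = (lam (Y `&` A) + lam (Y `&` ~` A))%E) by [].
rewrite !cara => mX Y; have := mX (shift (- c) Y).
rewrite lam_shift => ->.
rewrite -(lam_shift c (_ `&` X)) -(lam_shift c (_ `&` ~` X)).
by congr (lam _ + lam _)%E; apply/seteqP; split => x; rewrite /shift /= addrK.
Qed.

Lemma borel_lebesgue (X : set R) : measurable X -> measurable (X : set LT).
Proof. exact: sub_caratheodory. Qed.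

(** A Lebesgue measurable set is a Borel set joined with a subset of a Borel null set. The Borel
    part is what the density theorem is applied to. *)
Lemma borel_core (X : set LT) : measurable X ->
  exists F : set R, [/\ measurable F, F `<=` X & lebesgue_measure F = lam X].
Proof.
move=> mX.
have : (wlength (@idfun R))^*%mu.-cara.-measurable X by [].
rewrite -completed_caratheodory_measurable g_sigma_completed_algebra_genE.
move=> [F mF [N [N' [mN' N'0 NN']] FNX]]; exists F; split => //.
  by rewrite -FNX; exact: subsetUl.
apply/eqP; rewrite eq_le; apply/andP; split.
  by apply: (le_outer_measure ((wlength (@idfun R))^*)%mu); rewrite -FNX; exact: subsetUl.
apply: (@le_trans _ _ (lebesgue_measure (F `|` N'))).
  apply: (le_outer_measure ((wlength (@idfun R))^*)%mu).
  by rewrite -FNX; exact: setUS.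
by rewrite measureU0.
Qed.

(** By Lebesgue's theorem the density tends to 1 at almost every point of [F], so it exceeds 3/4 for
    small radii, in balls of length [2 * r]. *)
Lemma density_point (F : set R) : measurable F -> (0 < lebesgue_measure F)%E ->
  exists2 x, F x & \forall r \near 0^'+,
    ((3 / 2 * r)%:E < lebesgue_measure (F `&` ball x r))%E.
Proof.
move=> mF F0; have [N [mN N0 dN]] := lebesgue_density mF.
have [x [Fx Nx]] : exists x, F x /\ ~ N x.
  apply: contrapT => /forallNP h.
  have : lebesgue_measure F = 0%E.
    apply: (@subset_measure0 _ (measurableTypeR R) R (@lebesgue_measure R) F N) => //.
    by move=> x Fx; apply: contrapT => Nx; exact: (h x).
  by move=> e; move: F0; rewrite e ltxx.
exists x => //.
have : (lebesgue_measure (F `&` ball x r) * (lebesgue_measure (ball x r))^-1)%E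
                      @[r --> 0^'+] --> (\1_F x)%:E.
  by apply: contrapT => h; apply: Nx; apply: dN.
rewrite indicE mem_set//= => cv.
have h34 : \forall r \near 0^'+, ((3 / 4)%:E < lebesgue_measure (F `&` ball x r) *
    (lebesgue_measure (ball x r))^-1)%E.
  have n1 : nbhs (1 : R)%:E [set y | ((3 / 4)%:E < y)%E].
    by apply: (@nbhs_open_ereal_gt R 1 (fun=> 3 / 4)); lra.
  exact: (cv _ n1).
near=> r.
have r0 : 0 < r by near: r; exact: nbhs_right_gt.
have : ((3 / 4)%:E < lebesgue_measure (F `&` ball x r) * (lebesgue_measure (ball x r))^-1)%E.
  by near: r.
rewrite lebesgue_measure_ball ?(ltW r0)// inver mulrn_eq0/= gt_eqF// lte_pdivlMr ?mulrn_wgt0//.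
by rewrite -EFinM; congr (_%:E < _)%E; lra.
Unshelve. all: by end_near. Qed.

(** Around density points [x] and [y] each set has mass above [3 / 2 * r] in a ball of radius [r]. A
    rational translation within [r / 4] of [y - x] brings both parts into the ball of radius
    [5 / 4 * r] at [y], whose length [5 / 2 * r] is too small for disjoint parts. *)
Lemma steinhaus_rat (X Y : set LT) : measurable X -> measurable Y ->
  (0 < lam X)%E -> (0 < lam Y)%E -> exists (q : rat) x, X x /\ Y (x + ratr q).
Proof.
move=> /borel_core[F [mF FX <-]] /borel_core[G [mG GY <-]] F0 G0.
have [x Fx hx] := density_point mF F0; have [y Gy hy] := density_point mG G0.
near (0 : R)^'+ => r.
have r0 : 0 < r by near: r; exact: nbhs_right_gt.
have hx' : ((3 / 2 * r)%:E < lebesgue_measure (F `&` ball x r))%E by near: r.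
have hy' : ((3 / 2 * r)%:E < lebesgue_measure (G `&` ball y r))%E by near: r.
have [q] : exists q : rat, ratr q \in `]y - x - r / 4, y - x + r / 4[.
  by apply: rat_in_itvoo; lra.
rewrite in_itv/= => /andP[q1 q2]; exists q.
apply: contrapT => /forallNP h.
pose F' := shift (- ratr q) (F `&` ball x r).
have mB (u e : R) : measurable (ball u e) by exact: measurable_ball.
have mFx : measurable (F `&` ball x r : set LT).
  by apply: borel_lebesgue; exact: measurableI.
have mF' : measurable (F' : set LT) by exact: measurable_shift.
have mGy : measurable (G `&` ball y r : set LT).
  by apply: borel_lebesgue; exact: measurableI.
have mBy : measurable (ball y (5 / 4 * r) : set LT).
  by apply: borel_lebesgue; exact: mB.
have : (lam (F' `|` (G `&` ball y r)) <= lam (ball y (5 / 4 * r)))%E.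
  apply: le_measure; rewrite ?inE//; first exact: measurableU.
  move=> u [[_]|[_]]; rewrite /= /ball /= !ltr_norml => /andP[? ?]; apply/andP; split; lra.
rewrite (measure_disjU lam) //; last first.
  move=> u [Fu _] [Gu _]; apply: (h (u - ratr q)); split; first exact: FX.
  by rewrite subrK; exact: GY.
rewrite lam_shift leNgt => /negP; apply.
have -> : lam (ball y (5 / 4 * r)) = ((5 / 4 * r) *+ 2)%:E.
  by apply: lebesgue_measure_ball; lra.
apply: (@lt_trans _ _ ((3 / 2 * r)%:E + (3 / 2 * r)%:E)%E); last exact: lteD.
by rewrite -EFinD lte_fin; lra.
Unshelve. all: by end_near. Qed.

(** An enumeration of the rationals with repetitions: indices that encode no rational give 0. *)
Definition rat_seq (k : nat) : R := ratr (odflt 0 (unpickle k)).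

Lemma rat_seq_surj (q : rat) : exists k, rat_seq k = ratr q.
Proof. by exists (pickle q); rewrite /rat_seq pickleK. Qed.

(* The greedy exchange: at step [k] every remaining point of [A] whose
   translate by the [k]-th rational is a remaining point of [B] is used up. *)
Fixpoint remaining (A B : set R) (k : nat) : set R * set R :=
  if k is k'.+1 then
    let: (X, Y) := remaining A B k' in
    let S := X `&` shift (rat_seq k') Y in
    (X `\` S, Y `\` shift (- rat_seq k') S)
  else (A, B).

Section greedy.
Variables A B : set LT.
Hypotheses (mA : measurable A) (mB : measurable B).

Let X k := (remaining A B k).1.
Let Y k := (remaining A B k).2.
Let q := rat_seq.
Let S k : set LT := X k `&` shift (q k) (Y k).
Let J k : set LT := shift (- q k) (S k).

Let XS k : X k.+1 = X k `\` S k.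
Proof. by rewrite /S /X /Y /=; case: (remaining A B k). Qed.

Let YS k : Y k.+1 = Y k `\` J k.
Proof. by rewrite /J /S /X /Y /=; case: (remaining A B k). Qed.

Let mXY k : measurable (X k : set LT) /\ measurable (Y k : set LT).
Proof.
elim: k => [//|k [mX mY]]; rewrite XS YS.
by split; apply: measurableD => //; rewrite /J /S; do ?apply: measurable_shift;
  apply: measurableI => //; exact: measurable_shift.
Qed.

Let mS k : measurable (S k).
Proof.
by have [? ?] := mXY k; apply: measurableI => //; exact: measurable_shift.
Qed.

Let mJ k : measurable (J k).
Proof. exact: measurable_shift. Qed.

Let JY k : J k `<=` Y k.
Proof. by move=> y [_]; rewrite /shift /= subrK. Qed.

Let X_nincr j k : (j <= k)%N -> X k `<=` X j.
Proof.
by move=> /subnK <-; elim: (k - j)%N => [//|i IH]; rewrite addSn XS => x [/IH].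
Qed.

Let Y_nincr j k : (j <= k)%N -> Y k `<=` Y j.
Proof.
by move=> /subnK <-; elim: (k - j)%N => [//|i IH]; rewrite addSn YS => x [/IH].
Qed.

Let S_inj j k x : S j x -> S k x -> j = k.
Proof.
wlog jk : j k / (j < k)%N => [wl Sj Sk|Sj [Xk _]].
  by case: (ltngtP j k) => // jk; [exact: wl|apply/esym; exact: wl].
by have := X_nincr jk Xk; rewrite XS => -[].
Qed.

Let J_inj j k x : J j x -> J k x -> j = k.
Proof.
wlog jk : j k / (j < k)%N => [wl Sj Sk|Jj /JY Yk].
  by case: (ltngtP j k) => // jk; [exact: wl|apply/esym; exact: wl].
by have := Y_nincr jk Yk; rewrite YS => -[].
Qed.

Let A' := \bigcup_k S k.
Let B' := \bigcup_k J k.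
(** A point is moved by the rational of the unique step that uses it up; the default index concerns
    only points outside [A'], and likewise for [g] and [B']. *)
Let f (x : LT) : LT := (x : R) + q (xget 0%N [set k | S k x]).
Let g (y : LT) : LT := (y : R) - q (xget 0%N [set k | J k y]).

Let fE k x : S k x -> f x = x + q k.
Proof.
move=> Sk; rewrite /f; case: xgetP => [j _ /= Sj|/(_ k)//].
by rewrite (S_inj Sj Sk).
Qed.

Let gE k y : J k y -> g y = y - q k.
Proof.
move=> Jk; rewrite /g; case: xgetP => [j _ /= Jj|/(_ k)//].
by rewrite (J_inj Jj Jk).
Qed.

Let SJ k x : S k x -> J k (x + q k).
Proof. by rewrite /J /shift /= addrK. Qed.

Let JS k y : J k y -> S k (y - q k).
Proof. by []. Qed.

Let fpre E : A' `&` f @^-1` E = \bigcup_k (S k `&` shift (q k) E).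
Proof.
apply/seteqP; split => x.
  by move=> [[k _ Sk]] /=; rewrite (fE Sk) => Ex; exists k.
by move=> [k _ [Sk Ek]]; split; [exists k|rewrite /= (fE Sk)].
Qed.

Let gpre E : B' `&` g @^-1` E = \bigcup_k (J k `&` shift (- q k) E).
Proof.
apply/seteqP; split => x.
  by move=> [[k _ Sk]] /=; rewrite (gE Sk) => Ex; exists k.
by move=> [k _ [Sk Ek]]; split; [exists k|rewrite /= (gE Sk)].
Qed.

(** The parts used at one step are translates of each other, which gives the isomorphism. If both
    leftovers had positive measure, [steinhaus_rat] would give leftover points [x] and [x + q k],
    but step [k] would have used them up. *)
Lemma lebesgue_exchange : exists A1 B1 f1 g1, [/\ A1 `<=` A, B1 `<=` B,
  measure_iso lam A1 B1 f1 g1 & lam (A `\` A1) = 0%E \/ lam (B `\` B1) = 0%E].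
Proof.
have A'A : A' `<=` A by move=> x [k _ [/(X_nincr (leq0n k))]].
have B'B : B' `<=` B by move=> x [k _ /JY/(Y_nincr (leq0n k))].
have mA' : measurable A' by exact: bigcupT_measurable.
have mB' : measurable B' by exact: bigcupT_measurable.
exists A', B', f, g; split => //.
  split; first split => //.
  - move=> x [k _ Sk]; rewrite (fE Sk); split; first by exists k => //; exact: SJ.
    by rewrite (gE (SJ Sk)) addrK.
  - move=> y [k _ Jk]; rewrite (gE Jk); split; first by exists k.
    by rewrite (fE (JS Jk)) subrK.
  - split => E mE; rewrite ?fpre ?gpre; apply: bigcupT_measurable => k;
      by apply: measurableI => //; exact: measurable_shift.
  move=> E mE; rewrite fpre (_ : B' `&` E = \bigcup_k (J k `&` E)); last by rewrite setI_bigcupl.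
  have mSE k : measurable (S k `&` shift (q k) E : set LT).
    by apply: measurableI => //; exact: measurable_shift.
  have mJE k : measurable (J k `&` E) by exact: measurableI.
  have tS : trivIset setT (fun k => S k `&` shift (q k) E).
    by apply/trivIsetP => j k _ _ /eqP jk; apply/seteqP; split => // x [[h1 _] [h2 _]];
      case: jk; exact: S_inj h1 h2.
  have tJ : trivIset setT (fun k => J k `&` E).
    by apply/trivIsetP => j k _ _ /eqP jk; apply/seteqP; split => // x [[h1 _] [h2 _]];
      case: jk; exact: J_inj h1 h2.
  have -> : lam (\bigcup_k (S k `&` shift (q k) E)) =
      (\sum_(k <oo) lam (S k `&` shift (q k) E))%E.
    by rewrite (measure_bigcup lam)//; apply: eq_eseriesl => k; rewrite in_setT.
  have -> : lam (\bigcup_k (J k `&` E)) = (\sum_(k <oo) lam (J k `&` E))%E.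
    by rewrite (measure_bigcup lam)//; apply: eq_eseriesl => k; rewrite in_setT.
  apply: eq_eseriesr => k _; rewrite -(lam_shift (- q k)).
  by congr (lam _); apply/seteqP; split => x; rewrite /J /shift /= subrK.
apply: contrapT => /not_orP[hA hB].
have pos (Z : set LT) : lam Z <> 0%E -> (0 < lam Z)%E.
  by move=> h; rewrite lt_neqAle measure_ge0 andbT; apply/eqP => e; exact: h.
have [r [x [[Ax nA'x] [Bx nB'x]]]] := steinhaus_rat (measurableD mA mA') (measurableD mB mB')
  (pos _ hA) (pos _ hB).
have [k ek] := rat_seq_surj r; rewrite -ek in Bx nB'x.
have Xx j : X j x.
  elim: j => [//|j IH]; rewrite XS; split => // Sj; apply: nA'x; by exists j.
have Yx j : Y j (x + q k).
  elim: j => [//|j IH]; rewrite YS; split => // Sj; apply: nB'x; by exists j.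
by apply: nA'x; exists k => //; split => //; exact: Yx.
Qed.

End greedy.
End lebesgue_translation.

(** * Lower bound on the unit interval *)
Section Lam_bounds.
Context {R : realType} {d : measure_display} {T : measurableType d}.
Variables (mu : {measure set T -> \bar R}) (D : set T).

Lemma sqrt3_half_le1 : Num.sqrt 3 / 2 <= 1 :> R.
Proof. by rewrite ler_pdivrMr// mul1r -(@ler_pXn2r _ 2) ?nnegrE ?sqrt3_ge0// sqrt3_sqr; lra. Qed.

Lemma wide_lam_ratio (g : T -> R[i]) S z x : wide z (g x) (g (S x)) ->
  Num.sqrt 3 / 2 <= lam_ratio g S z x.
Proof.
rewrite /wide /lam_ratio => h; case: ifPn => [_|den0]; first exact: sqrt3_half_le1.
by rewrite ler_pdivlMr// lt_neqAle eq_sym den0 addr_ge0 ?cabs_ge0.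
Qed.

Lemma le_Lam (g : T -> R[i]) S z M (c : R) : measurable D -> measurable M -> mu (D `\` M) = 0%E ->
  (forall x, D x -> M x -> c <= lam_ratio g S z x) -> (c%:E <= Lam mu D g S z)%E.
Proof.
move=> mD mM DM0 h; apply: ereal_sup_ubound => /=.
exists (D `\` M); split => //; first exact: measurableD.
move=> x /= /not_implyP[Dx nx]; split => // Mx; apply: nx.
by rewrite lee_fin; exact: h.
Qed.

Lemma le_Lam_sup (g : T -> R[i]) S z : is_aut mu D S -> (Lam mu D g S z <= Lam_sup mu D g)%E.
Proof. by move=> autS; apply: ereal_sup_ubound; exists S => //; exists z. Qed.

Lemma involution_is_aut (M : set T) f : measurable D -> measure_involution mu M f ->
  M `<=` D -> mu (D `\` M) = 0%E -> is_aut mu D f.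
Proof.
move=> mD [mM ff muf] MD M0; exists M, M, f; split; [by split|split; first split].
- split.
  + by move=> x Mx; exact: (ff x Mx).1.
  + move=> x y; rewrite !inE => Mx My e.
    by rewrite -(ff x Mx).2 e (ff y My).2.
  + by move=> y My; exists (f y); [exact: (ff y My).1|exact: (ff y My).2].
- by move=> x Mx; exact: (ff x Mx).2.
- by move=> y My; have [? ?] := ff y My; split => //; rewrite inE.
- by move=> _ E mE; exact: (muf E mE).1.
- by move=> _ E mE; exact: (muf E mE).1.
(* The part of [E] outside [M] lies in the null set [D \ M]. *)
move=> E mE ED; rewrite (muf E mE).2.
apply: measure_full => //; first exact: measurableI.
apply: (@subset_measure0 _ _ _ _ _ (D `\` M)) => //.
- by apply: measurableD => //; exact: measurableI.
- exact: measurableD.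
- by move=> x [Ex nx]; split; [exact: ED|move=> Mx; apply: nx].
Qed.

End Lam_bounds.

(** * Subsets of prescribed measure and isomorphisms in [0, 1] *)

Section unit_interval.
Context {R : realType}.
Local Notation LT := (@lebesgueType R).
Local Notation lam := (@lam R).
Local Notation D := (@Omega_inf R : set LT).

Lemma lam_itv (a b : R) : a <= b -> lam `[a, b]%classic = (b - a)%:E.
Proof.
move=> ab; transitivity (lebesgue_measure (`[a, b]%classic : set R)) => //.
rewrite lebesgue_measure_itv /= lte_fin; case: ltP => [_|ba]; first by rewrite -EFinB.
by rewrite (@le_anti _ _ a b) ?ab ?ba// subrr.
Qed.

Lemma measurable_Omega_inf : measurable D.
Proof. by apply: borel_lebesgue; exact: measurable_itv. Qed.
Local Hint Resolve measurable_Omega_inf : core.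

Lemma lam_Omega_inf : lam D = 1%E.
Proof. by rewrite lam_itv// subr0. Qed.

Let Doo : (lam D < +oo)%E.
Proof. by rewrite lam_Omega_inf ltry. Qed.

(** The exchange exhausts [A] or [V]. In the latter case the part of [V] used has mass
    [lam V >= lam A], and it cannot exceed [lam A]. *)
Lemma lam_sub_ex (A V : set LT) : measurable A -> measurable V -> A `<=` D ->
  V `<=` D -> (lam A <= lam V)%E ->
  exists V', [/\ measurable V', V' `<=` V & lam V' = lam A].
Proof.
move=> mA mV AD VD AV.
have [A1 [B1 [f [g [A1A B1V iso h]]]]] := lebesgue_exchange mA mV.
have [[mA1 mB1 _ _ _] _] := iso.
have e := measure_iso_measure iso; exists B1; split => //.
apply/eqP; rewrite eq_le; apply/andP; split; rewrite -e.
  by apply: le_measure; rewrite ?inE.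
case: h => h; first by rewrite (measure_full mA1 mA A1A h).
by rewrite e (measure_full mB1 mV B1V h).
Qed.

(** As the two total masses are equal and finite, a null leftover on one side makes the other
    leftover null. *)
Lemma lam_iso_ex (A B : set LT) : measurable A -> measurable B -> A `<=` D ->
  B `<=` D -> lam A = lam B -> exists A' B' f g, [/\ A' `<=` A, B' `<=` B,
    lam (A `\` A') = 0%E, lam (B `\` B') = 0%E & measure_iso lam A' B' f g].
Proof.
move=> mA mB AD BD AB.
have [A1 [B1 [f [g [A1A B1B iso h]]]]] := lebesgue_exchange mA mB.
have [[mA1 mB1 _ _ _] _] := iso.
have e := measure_iso_measure iso; exists A1, B1, f, g.
have [hA hB] : lam A1 = lam A /\ lam B1 = lam B.
  case: h => h; have h' := measure_full _ _ _ h.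
    by rewrite -e -AB h'.
  by rewrite e AB h'.
split => //.
  exact: (eq_measure_setD0 measurable_Omega_inf Doo mA1 mA AD A1A hA).
exact: (eq_measure_setD0 measurable_Omega_inf Doo mB1 mB BD B1B hB).
Qed.

(** The mass [c] missing from [U] is that of the interval [[0, c]], and [lam_sub_ex] finds a subset
    of [V \ U] with the same mass. *)
Lemma lam_half_ex (U V : set LT) : measurable U -> measurable V -> U `<=` V ->
  V `<=` D -> (lam U <= (1 / 2)%:E <= lam V)%E ->
  exists H, [/\ measurable H, U `<=` H, H `<=` V & lam H = (1 / 2)%:E].
Proof.
move=> mU mV UV VD /andP[hU hV].
have UD := subset_trans UV VD.
have fU : lam U \is a fin_num by exact: (fin_measure_sub measurable_Omega_inf Doo).
have mVU : measurable (V `\` U) by exact: measurableD.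
pose c := 1 / 2 - fine (lam U).
have c0 : 0 <= c by rewrite subr_ge0 -lee_fin fineK.
have c1 : c <= 1.
  have : 0 <= fine (lam U) by rewrite fine_ge0 ?measure_ge0.
  by rewrite /c; move: (fine (lam U)) => t t0; clear -t0; lra.
have eV : (lam (V `\` U) + lam U = lam V)%E.
  by have := measureDI lam mV mU; rewrite setIidr.
have [|||||V' [mV' V'V eV']] := @lam_sub_ex `[0, c]%classic (V `\` U).
- by apply: borel_lebesgue; exact: measurable_itv.
- by [].
- by move=> x /=; rewrite /Omega_inf /= !in_itv/= => /andP[-> h]; exact: le_trans c1.
- by move=> x [/VD].
- rewrite lam_itv// subr0 -(leeD2rE _ _ fU) eV.
  by apply: le_trans hV; rewrite -(fineK fU) -EFinD lee_fin /c subrK.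
exists (U `|` V'); split.
- exact: measurableU.
- exact: subsetUl.
- by move=> x [/UV|/V'V[]].
rewrite (measure_disjU lam)//; last by move=> x Ux /V'V[].
by rewrite eV' lam_itv// subr0 -(fineK fU) -EFinD /c addrC subrK.
Qed.

Lemma Lam_inf_ge (g : LT -> R[i]) : cmeas D g ->
  exists S z, is_aut lam D S /\ ((Num.sqrt 3 / 2)%:E <= Lam lam D g S z)%E.
Proof.
move=> mg.
have [z [M [f [MD M0 invf Wf]]]] :=
  exists_wide_involution measurable_Omega_inf lam_Omega_inf lam_iso_ex lam_sub_ex lam_half_ex mg.
have mM : measurable M by case: invf.
exists f, z; split; first exact: (involution_is_aut measurable_Omega_inf invf MD M0).
apply: (le_Lam measurable_Omega_inf mM M0) => x Dx Mx.
by apply: wide_lam_ratio; exact: Wf.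
Qed.

End unit_interval.

(** * Hall's theorem and finite spaces *)
Section hall.
Variable T : finType.
Implicit Types (r : rel T) (A B X : {set T}).

Definition nbr r A : {set T} := [set y | [exists x in A, r x y]]%SET.

Lemma nbrP r A y : reflect (exists2 x, x \in A & r x y) (y \in nbr r A).
Proof. by rewrite inE; apply: (iffP exists_inP). Qed.

Lemma nbrU r A B : nbr r (A :|: B)%SET = (nbr r A :|: nbr r B)%SET.
Proof.
apply/setP => y; rewrite finset.in_setU; apply/nbrP/orP.
  by move=> [x]; rewrite finset.in_setU => /orP[] ? ?; [left|right]; apply/nbrP; exists x.
by move=> [] /nbrP[x xA rxy]; exists x => //; rewrite finset.in_setU xA ?orbT.
Qed.

Lemma nbr_del r A B : nbr (fun x y => r x y && (y \notin B)) A = (nbr r A :\: B)%SET.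
Proof.
apply/setP => y; rewrite finset.in_setD; apply/nbrP/andP.
  by move=> [x xA /andP[rxy ->]]; split => //; apply/nbrP; exists x.
by move=> [yB /nbrP[x xA rxy]]; exists x => //; rewrite rxy.
Qed.

(** Induction on the size of [X]. If some nonempty proper subset [A] has exactly as many neighbours
    as elements, [A] and its complement are matched separately, the latter outside the neighbours of
    [A]. Otherwise every such subset has a spare neighbour, and one pair [x0], [y0] can be
    removed. *)
Theorem hall_marriage r X : (forall A, (A \subset X -> #|A| <= #|nbr r A|)%N) ->
  exists f : T -> T, {in X &, injective f} /\ {in X, forall x, r x (f x)}.
Proof.
have [k] := ubnP #|X|; elim: k r X => // k IH r X; rewrite ltnS => Xk hall.
have [->|/finset.set0Pn[x0 x0X]] := eqVneq X finset.set0.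
  by exists id; split=> [x y|x]; rewrite finset.in_set0.
have [/existsP[A /and4P[AX An0 AnX /eqP eA]]|/existsPn tight] :=
  boolP [exists A : {set T}, [&& A \subset X, A != finset.set0, A != X & #|A| == #|nbr r A|]].
  have pA : A \proper X by rewrite finset.properEneq AnX.
  have [||f1 [inj1 rf1]] := IH r A; first by rewrite (leq_trans (proper_card pA)).
    by move=> B BA; apply: hall; exact: fintype.subset_trans AX.
  pose r' x y := r x y && (y \notin nbr r A).
  have [||f2 [inj2 rf2]] := IH r' (X :\: A)%SET.
  - apply: leq_trans Xk; apply: proper_card; rewrite finset.properEneq finset.subsetDl andbT.
    apply/eqP => e; case/finset.set0Pn: An0 => x xA.
    by have := fintype.subsetP AX _ xA; rewrite -e finset.in_setD xA.
  (* The condition for the union of [A] and [B], minus the equality for [A], is the condition for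
     [B] after the deletion. *)
  - move=> B BXA; rewrite nbr_del finset.cardsD.
    have BX : B \subset X by apply: fintype.subset_trans BXA _; exact: finset.subsetDl.
    have AB0 : (A :&: B)%SET = finset.set0.
      apply/setP => x; rewrite finset.in_setI finset.in_set0; apply/negP => /andP[xA /(fintype.subsetP BXA)].
      by rewrite finset.in_setD xA.
    have := hall (A :|: B)%SET; rewrite finset.subUset AX BX => /(_ isT).
    rewrite nbrU !finset.cardsU AB0 cards0 subn0 -eA (finset.setIC (nbr r B)).
    have : (#|(nbr r A :&: nbr r B)%SET| <= #|nbr r B|)%N by exact: subset_leq_card (finset.subsetIr _ _).
    by rewrite -/r'; lia.
  exists (fun x => if x \in A then f1 x else f2 x); split=> [x y xX yX|x xX]; last first.
    case: ifPn => xA; first exact: rf1.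
    by have := rf2 x; rewrite finset.in_setD xA xX => /(_ isT)/andP[].
  have nA u : u \in X -> u \notin A -> f2 u \notin nbr r A.
    by move=> uX uA; have := rf2 u; rewrite finset.in_setD uA uX => /(_ isT)/andP[].
  have iA u : u \in A -> f1 u \in nbr r A by move=> uA; apply/nbrP; exists u => //; exact: rf1.
  case: ifPn => xA; case: ifPn => yA e.
  - exact: inj1.
  - by have := nA _ yX yA; rewrite -e iA.
  - by have := nA _ xX xA; rewrite e iA.
  - by apply: inj2 => //; rewrite finset.in_setD ?xA ?yA.
have [y0 rx0] : exists y0, r x0 y0.
  have : (0 < #|nbr r [set x0]%SET|)%N.
    by apply: leq_trans (hall _ _); rewrite ?finset.sub1set// cards1.
  by move=> /card_gt0P[y0 /nbrP[x1 /finset.set1P -> rx0]]; exists y0.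
pose r' x y := r x y && (y \notin [set y0]%SET).
have [||f [injf rf]] := IH r' (X :\ x0)%SET.
- by rewrite (cardsD1 x0 X) x0X add1n in Xk.
- move=> B BX; rewrite nbr_del.
  have [->|Bn0] := eqVneq B finset.set0; first by rewrite cards0.
  have BX' : B \subset X by apply: fintype.subset_trans BX _; exact: finset.subsetDl.
  have BnX : B != X.
    by apply/eqP => e; have := fintype.subsetP BX x0; rewrite e x0X finset.in_setD1 eqxx => /(_ isT).
  have := tight B; rewrite BX' Bn0 BnX /= => neq.
  have lt : (#|B| < #|nbr r B|)%N by rewrite ltn_neqAle neq hall.
  have := cardsD1 y0 (nbr r B); lia.
exists (fun x => if x == x0 then y0 else f x); split=> [x y xX yX|x xX]; last first.
  case: eqP => [->//|/eqP xx0].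
  by have := rf x; rewrite finset.in_setD1 xx0 xX => /(_ isT)/andP[].
have nf u : u \in X -> u != x0 -> f u != y0.
  move=> uX ux0; have := rf u; rewrite finset.in_setD1 ux0 uX => /(_ isT)/andP[_].
  by rewrite finset.in_set1.
case: eqP => [->|/eqP xx0]; case: eqP => [->//|/eqP yx0] e.
- by have := nf _ yX yx0; rewrite -e eqxx.
- by have := nf _ xX xx0; rewrite e eqxx.
- by apply: injf => //; rewrite finset.in_setD1 ?xx0 ?yx0.
Qed.
End hall.

(** * Normalized counting measure in terms of cardinalities *)

Section finite_space.
Context {R : realType}.
Local Open Scope card_scope.
Implicit Types (A B E U V : set nat).

Lemma Omega_fin_card n : Omega_fin n #= `I_n.
Proof.
apply/card_esym/card_set_bijP; exists succn; split.
- by move=> k /= kn; rewrite /Omega_fin /=.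
- by move=> j k _ _ [].
- by move=> [|k] /= //; rewrite /Omega_fin /= => kn; exists k.
Qed.

Lemma Omega_fin_finite n : finite_set (Omega_fin n).
Proof. by exists n; exact: Omega_fin_card. Qed.

Lemma mu_fin_card n A a : A #= `I_a -> @mu_fin R n A = (n%:R^-1 * a%:R)%:E.
Proof.
move=> Aa; transitivity ((n%:R^-1)%:E * (@counting nat R A : \bar R))%E => //.
by rewrite /counting asboolT; [rewrite (card_fset_set Aa) -EFinM|exists a].
Qed.

Lemma mu_fin_eq n A B : finite_set B -> A #= B -> @mu_fin R n A = mu_fin n B.
Proof.
move=> [b Bb] AB; rewrite (mu_fin_card n Bb).
by apply: mu_fin_card; exact: card_eq_trans Bb.
Qed.

Lemma mu_fin_le n A B a b : (0 < n)%N -> A #= `I_a -> B #= `I_b ->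
  (@mu_fin R n A <= mu_fin n B)%E = (a <= b)%N.
Proof.
move=> n0 Aa Bb; rewrite (mu_fin_card n Aa) (mu_fin_card n Bb) lee_fin.
by rewrite ler_pM2l ?invr_gt0 ?ltr0n// ler_nat.
Qed.

Lemma mu_fin_eq0 n A : (0 < n)%N -> finite_set A -> @mu_fin R n A = 0%E -> A = set0.
Proof.
move=> n0 [a Aa]; rewrite (mu_fin_card n Aa) => -[/eqP].
rewrite mulf_eq0 invr_eq0 !pnatr_eq0 gtn_eqF//= => /eqP a0.
by move: Aa; rewrite a0 II0 card_eq0 => /eqP.
Qed.

Lemma mu_fin_Omega n : (0 < n)%N -> @mu_fin R n (Omega_fin n) = 1%E.
Proof.
by move=> n0; rewrite (mu_fin_card n (Omega_fin_card n)) mulVf// pnatr_eq0 gtn_eqF.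
Qed.

Lemma measurable_nat A : measurable A.
Proof. by []. Qed.

Lemma set_bij_iso n A B f : finite_set B -> set_bij A B f ->
  exists g, measure_iso (@mu_fin R n) A B f g.
Proof.
move=> fB [fAB finj fsurj].
pose g y := xget 0%N [set x | A x /\ f x = y].
have gP y : B y -> A (g y) /\ f (g y) = y.
  by move=> /fsurj[x Ax <-]; rewrite /g; case: xgetP => [z _ //|/(_ x)[]].
exists g; split; first split => //.
  move=> x Ax; have Bfx := fAB _ Ax; split => //; have [Ag e] := gP _ Bfx.
  by apply: finj; rewrite ?inE.
move=> E _; apply: mu_fin_eq; first by apply: sub_finite_set fB; exact: subIsetl.
apply/card_set_bijP; exists f; split.
- by move=> x [Ax Ex]; split => //; exact: fAB.
- by move=> x y; rewrite !inE => -[Ax _] [Ay _]; apply: finj; rewrite inE.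
- by move=> y [/fsurj[x Ax <-] Ey]; exists x.
Qed.

Lemma finite_subset_card V a v : V #= `I_v -> (a <= v)%N ->
  exists V', V' `<=` V /\ V' #= `I_a.
Proof.
move=> /card_esym/card_set_bijP[h [hf hinj _]] av.
have sub : `I_a `<=` `I_v by move=> k /= /leq_trans; exact.
exists (h @` `I_a); split; first by move=> _ [k /sub/hf ? <-].
by apply: inj_card_eq => j k; rewrite !inE => /sub ? /sub ?; apply: hinj; rewrite inE.
Qed.

Section finite_hypotheses.
Variable n : nat.
Hypothesis n0 : (0 < n)%N.
Local Notation D := (Omega_fin n).

Lemma mu_fin_iso_ex A B : measurable A -> measurable B -> A `<=` D -> B `<=` D ->
  @mu_fin R n A = mu_fin n B -> exists A' B' f g, [/\ A' `<=` A, B' `<=` B,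
    mu_fin n (A `\` A') = 0%E :> \bar R, mu_fin n (B `\` B') = 0%E :> \bar R &
    measure_iso (@mu_fin R n) A' B' f g].
Proof.
move=> _ _ AD BD e.
have fA := sub_finite_set AD (Omega_fin_finite n).
have fB := sub_finite_set BD (Omega_fin_finite n).
have [a Aa] := fA; have [b Bb] := fB.
have ab : a = b.
  by apply/eqP; rewrite eqn_leq -(mu_fin_le n0 Aa Bb) -(mu_fin_le n0 Bb Aa) e lexx.
have /card_set_bijP[f bf] : A #= B.
  by apply: (card_eq_trans Aa); rewrite ab card_eq_sym.
have [g iso] := set_bij_iso n fB bf.
by exists A, B, f, g; split; rewrite ?setDv ?measure0.
Qed.

Lemma mu_fin_sub_ex A V : measurable A -> measurable V -> A `<=` D ->
  V `<=` D -> (@mu_fin R n A <= mu_fin n V)%E ->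
  exists V', [/\ measurable V', V' `<=` V & @mu_fin R n V' = mu_fin n A].
Proof.
move=> _ _ AD VD AV.
have [a Aa] := sub_finite_set AD (Omega_fin_finite n).
have [v Vv] := sub_finite_set VD (Omega_fin_finite n).
have [V' [V'V V'a]] := finite_subset_card Vv (etrans (esym (mu_fin_le n0 Aa Vv)) AV).
by exists V'; split => //; rewrite (mu_fin_card n V'a) (mu_fin_card n Aa).
Qed.

(** With [n] even, mass 1/2 means exactly [m] points, so [U] is completed by [m - u] points of
    [V \ U]. *)
Lemma mu_fin_half_ex m U V : n = m.*2 -> measurable U -> measurable V -> U `<=` V ->
  V `<=` D -> (@mu_fin R n U <= (1 / 2)%:E <= @mu_fin R n V)%E ->
  exists H, [/\ measurable H, U `<=` H, H `<=` V & @mu_fin R n H = (1 / 2)%:E].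
Proof.
move=> nm _ _ UV VD.
have half : (1 / 2)%:E = (n%:R^-1 * m%:R)%:E :> \bar R.
  congr EFin; have : n%:R != 0 :> R by rewrite pnatr_eq0 gtn_eqF.
  by rewrite nm -muln2 natrM => h; field; move: h; rewrite mulf_eq0 negb_or => /andP[].
have [u Uu] := sub_finite_set (subset_trans UV VD) (Omega_fin_finite n).
have [v Vv] := sub_finite_set VD (Omega_fin_finite n).
have [w Ww] := sub_finite_set (subset_trans (@subDsetl _ V U) VD) (Omega_fin_finite n).
have muV : (@mu_fin R n V = mu_fin n U + mu_fin n (V `\` U))%E.
  rewrite -(measure_disjU (mu_fin n))//; last by move=> x Ux [].
  by rewrite setDUK.
have vuw : v = (u + w)%N.
  move: muV; rewrite (mu_fin_card n Vv) (mu_fin_card n Uu) (mu_fin_card n Ww) -EFinD -mulrDr -natrD.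
  move=> -[] /mulfI; rewrite invr_eq0 pnatr_eq0 gtn_eqF// => /(_ isT)/eqP.
  by rewrite eqr_nat => /eqP.
rewrite half (mu_fin_card n Vv) (mu_fin_card n Uu) !lee_fin !ler_pM2l ?invr_gt0 ?ltr0n// !ler_nat.
move=> /andP[um mv].
have [W [WV Wa]] : exists W, W `<=` V `\` U /\ W #= `I_(m - u).
  by apply: finite_subset_card Ww _; lia.
exists (U `|` W); split => //.
- by move=> x [/UV|/WV[]].
rewrite (measure_disjU (mu_fin n))//; last by move=> x Ux /WV[].
by rewrite (mu_fin_card n Uu) (mu_fin_card n Wa) -EFinD -mulrDr -natrD subnKC.
Qed.

End finite_hypotheses.

Lemma fin_is_aut n S S' : (forall k, Omega_fin n k -> Omega_fin n (S k) /\ S' (S k) = k) ->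
  (forall k, Omega_fin n k -> Omega_fin n (S' k) /\ S (S' k) = k) ->
  is_aut (@mu_fin R n) (Omega_fin n) S.
Proof.
move=> SS' S'S; exists (Omega_fin n), (Omega_fin n), S'; split.
  by split => //; rewrite setDv measure0.
have bij : set_bij (Omega_fin n) (Omega_fin n) S.
  split.
  - by move=> k /SS'[].
  - by move=> j k; rewrite !inE => /SS'[_ ej] /SS'[_ ek] e; rewrite -ej e ek.
  - by move=> k Dk; have [? ?] := S'S k Dk; exists (S' k).
split; first split => //.
- by move=> k /SS'[].
- by move=> k /S'S[? ?]; split => //; rewrite inE.
move=> E _ ED; have [g [_ muS]] := set_bij_iso n (Omega_fin_finite n) bij.
by rewrite muS// setIidr.
Qed.

End finite_space.

(** * Lower bound on finite spaces *)
Section finite_lower_bound.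
Context {R : realType}.

(* Doubling every point makes the cardinality even, so that exact halves exist. *)
Lemma wide_doubled_involution n (g : nat -> R[i]) : (0 < n)%N ->
  exists z f, forall k, Omega_fin n.*2 k ->
    [/\ Omega_fin n.*2 (f k), f (f k) = k & wide z (g (uphalf k)) (g (uphalf (f k)))].
Proof.
move=> n0; have N0 : (0 < n.*2)%N by rewrite double_gt0.
(* The copies of the point [k] are [2k - 1] and [2k], the two numbers that [uphalf] sends to [k]. *)
have mg : cmeas (Omega_fin n.*2) (g \o uphalf) by [].
have [z [M [f [MD M0 [_ ff _] Wf]]]] := exists_wide_involution
  (measurable_nat (Omega_fin n.*2)) (@mu_fin_Omega R _ N0) (@mu_fin_iso_ex R _ N0)
  (@mu_fin_sub_ex R _ N0) (fun U V => @mu_fin_half_ex R _ N0 n U V erefl) mg.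
have DM : Omega_fin n.*2 `<=` M.
  have := mu_fin_eq0 N0 (sub_finite_set (@subDsetl _ _ M) (Omega_fin_finite _)) M0.
  by rewrite -subset0 => h k Dk; apply: contrapT => nM; exact: (h k).
by exists z, f => k /DM Mk; have [? ?] := ff k Mk; split => //; [exact: MD|exact: Wf].
Qed.

(** The involution sends the [2 |A|] copies of the points of [A] injectively to copies of neighbours
    of [A]; halving gives the condition of [hall_marriage]. *)
Lemma wide_permutation n (g : nat -> R[i]) : exists z (s : 'I_n.+1 -> 'I_n.+1),
  injective s /\ forall i : 'I_n.+1, wide z (g i.+1) (g (s i).+1).
Proof.
have [z [f hf]] := @wide_doubled_involution n.+1 g isT.
pose r : rel 'I_n.+1 := fun i j => wide z (g i.+1) (g j.+1).
(* Ordinals start at 0 and points at 1: the pair [(i, b)] stands for copy [b] of the point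
   [i + 1]. *)
pose num (p : 'I_n.+1 * bool) : nat := (p.2 + p.1.*2).+1.
pose den (k : nat) : 'I_n.+1 * bool := (inord k.-1./2, odd k.-1).
have numD p : Omega_fin n.+1.*2 (num p).
  by case: p => i b; have := ltn_ord i; rewrite /Omega_fin /num /=; lia.
have numK p : uphalf (num p) = p.1.+1.
  by case: p => i b; rewrite /num /= half_bit_double.
have denK k : Omega_fin n.+1.*2 k -> num (den k) = k.
  case: k => [//|k]; rewrite /Omega_fin /num /den /= => kn.
  by rewrite inordK ?odd_double_half//; lia.
pose phi p := den (f (num p)).
have phi_inj : injective phi.
  move=> p q /(congr1 num); have [Dp fp _] := hf _ (numD p); have [Dq fq _] := hf _ (numD q).
  rewrite /phi !denK// => /(congr1 f); rewrite fp fq => e.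
  have e1 : p.1 = q.1 by apply/val_inj; have := congr1 uphalf e; rewrite !numK => -[].
  move: e; case: p q e1 {Dp fp Dq fq} => i b [j c] /= ->.
  by rewrite /num /= => -[/addIn]; case: b; case: c.
have rphi p : r p.1 (phi p).1.
  have [Dp _ w] := hf _ (numD p); rewrite /r.
  by move: w; rewrite numK -[in uphalf _](denK _ Dp) numK.
have hall (A : {set 'I_n.+1}) : A \subset [set: 'I_n.+1]%SET -> (#|A| <= #|nbr r A|)%N.
  move=> _; rewrite -(@leq_pmul2r 2)// -card_bool -!finset.cardsT -!finset.cardsX.
  rewrite -(card_imset (mem (finset.setX A [set: bool]%SET)) phi_inj); apply: subset_leq_card.
  apply/fintype.subsetP => _ /imsetP[[i b] /finset.setXP[iA _] ->].
  rewrite [phi _]surjective_pairing; apply/finset.setXP; split; last by rewrite finset.in_setT.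
  by apply/nbrP; exists i => //; exact: (rphi (i, b)).
have [s [sinj rs]] := hall_marriage hall.
exists z, s; split; first by move=> i j; apply: sinj; rewrite finset.in_setT.
by move=> i; apply: rs; rewrite finset.in_setT.
Qed.

Lemma Lam_fin_ge n (g : nat -> R[i]) : (0 < n)%N ->
  exists S z, is_aut (@mu_fin R n) (Omega_fin n) S /\
    ((Num.sqrt 3 / 2)%:E <= Lam (@mu_fin R n) (Omega_fin n) g S z)%E.
Proof.
case: n => // n _; have [z [s [sinj ws]]] := wide_permutation n g.
pose S k := (s (inord k.-1)).+1; pose S' k := (invF sinj (inord k.-1)).+1.
have autS : is_aut (@mu_fin R n.+1) (Omega_fin n.+1) S.
  apply: (@fin_is_aut _ _ _ S') => -[//|k] kn; rewrite /S /S' /Omega_fin /=.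
    by rewrite inord_val invF_f inordK//; have := ltn_ord (s (inord k)).
  by rewrite inord_val f_invF inordK//; have := ltn_ord (invF sinj (inord k)).
exists S, z; split => //.
apply: (@le_Lam _ _ _ _ _ _ _ _ (Omega_fin n.+1)) => //; first by rewrite setDv measure0.
move=> [//|k] kn _; apply: wide_lam_ratio.
by have := ws (inord k); rewrite /S /= inordK.
Qed.

End finite_lower_bound.

(** * Upper bound *)
Section triangle.
Context {R : realType}.

(** Cauchy-Schwarz, from Lagrange's identity with the square of the determinant. *)
Lemma norm2_dot_le (x y x' y' : R) : x * x' + y * y' <= norm2 x y * norm2 x' y'.
Proof.
have [h|h] := leP (x * x' + y * y') 0.
  by apply: le_trans h _; rewrite mulr_ge0 ?norm2_ge0.
rewrite -(@ler_pXn2r _ 2) ?nnegrE ?mulr_ge0 ?norm2_ge0 ?(ltW h)//.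
rewrite exprMn !norm2_sqr.
by have := sqr_ge0 (x * y' - y * x'); lra.
Qed.

Lemma cabs_triangle (p q z : R[i]) : cabs (p - q) <= cabs (p - z) + cabs (q - z).
Proof.
case: p q z => [p1 p2] [q1 q2] [z1 z2]; rewrite !cabsE /=.
have -> : p1 - q1 = (p1 - z1) - (q1 - z1) by lra.
have -> : p2 - q2 = (p2 - z2) - (q2 - z2) by lra.
move: (p1 - z1) (p2 - z2) (q1 - z1) (q2 - z2) => x y x' y'.
rewrite -(@ler_pXn2r _ 2) ?nnegrE ?addr_ge0 ?norm2_ge0//.
have h := norm2_dot_le x y (- x') (- y').
have e : norm2 (- x') (- y') = norm2 x' y' by rewrite /norm2 !sqrrN.
rewrite e in h; rewrite sqrrD !norm2_sqr; lra.
Qed.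

Lemma cabs0_eq (p : R[i]) : cabs p = 0 -> p = 0.
Proof.
case: p => [a b]; rewrite cabsE /= => /eqP; apply: contraTeq => ab.
rewrite gt_eqF// norm2_gt0//; move: ab; apply: contraNT.
by rewrite negb_or !negbK => /andP[/eqP-> /eqP->].
Qed.

Lemma lt_half_compl (t : R) : t < 1 / 2 -> 1 / 2 < 1 - t.
Proof. lra. Qed.

(** The cube roots of unity: a triangle of circumradius 1 and side [Num.sqrt 3]. *)
Definition vertex (k : 'I_3) : R[i] := Complex
  ([:: 1; - 1 / 2; - 1 / 2]`_k) ([:: 0; Num.sqrt 3 / 2; - (Num.sqrt 3 / 2)]`_k).

Lemma cabs_vertex k : cabs (vertex k) = 1.
Proof.
have r3 := @sqrt3_sqr R.
rewrite cabsE /= /norm2 -[RHS]sqrtr1; congr Num.sqrt.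
by case: k => -[|[|[|//]]] ?; move: r3; rewrite /= !expr2; lra.
Qed.

Lemma cabs_vertexB j k : j != k -> cabs (vertex j - vertex k) = Num.sqrt 3.
Proof.
have r3 := @sqrt3_sqr R.
move=> jk; rewrite cabsE /= /norm2; congr Num.sqrt; move: jk.
case: j => -[|[|[|//]]] ?; case: k => -[|[|[|//]]] ?; rewrite -?val_eqE //= => _;
  by move: r3; rewrite !expr2; lra.
Qed.

(* Project [vertex k - z] on the unit vector [vertex k]; the vertices sum to 0. *)
Lemma fermat_triangle (z : R[i]) : 3 <= \sum_k cabs (vertex k - z).
Proof.
have dot k : 1 - (complex.Re (vertex k) * complex.Re z + complex.Im (vertex k) * complex.Im z)
    <= cabs (vertex k - z).
  have := norm2_dot_le (complex.Re (vertex k - z)) (complex.Im (vertex k - z))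
    (complex.Re (vertex k)) (complex.Im (vertex k)).
  rewrite -!cabsE cabs_vertex mulr1; apply: le_trans.
  have := cabs_vertex k => /(congr1 (fun t => t ^+ 2)); rewrite cabsE norm2_sqr expr1n.
  by case: z (vertex k) => [z1 z2] [k1 k2] /=; lra.
have : \sum_k (1 - (complex.Re (vertex k) * complex.Re z + complex.Im (vertex k) * complex.Im z))
    <= \sum_k cabs (vertex k - z) by apply: ler_sum => k _; exact: dot.
apply: le_trans.
by rewrite !big_ord_recl big_ord0 /=; lra.
Qed.

(** [lam_ratio g S z x] is convertible to [edge_ratio z (g x) (g (S x))]. *)
Definition edge_ratio (z p q : R[i]) : R :=
  let den := cabs (p - z) + cabs (q - z) in
  if den == 0 then 1 else cabs (p - q) / den.

Lemma edge_ratio_le1 z p q : edge_ratio z p q <= 1.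
Proof.
rewrite /edge_ratio; case: ifPn => // den0.
rewrite ler_pdivrMr ?mul1r ?cabs_triangle//.
by rewrite lt_neqAle eq_sym den0 addr_ge0 ?cabs_ge0.
Qed.

(** For distinct vertices the bound means that their distances from [z] sum to at least 2. Some pair
    has this property, since otherwise all three distances would sum to less than 3, against
    [fermat_triangle]. For equal vertices the ratio is 0 unless [z] is that vertex, which is the
    reason for treating this position of [z] first. *)
Lemma edge_ratio_vertex z : exists k : 'I_3, forall i j, i != k -> j != k ->
  edge_ratio z (vertex i) (vertex j) <= Num.sqrt 3 / 2.
Proof.
have r0 : 0 < Num.sqrt 3 :> R by rewrite sqrtr_gt0.
have r3 := @sqrt3_sqr R.
pose dz i := cabs (vertex i - z).
have dz0 i : 0 <= dz i by exact: cabs_ge0.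
suff [k hk] : exists k : 'I_3, (forall i, i != k -> 0 < dz i) /\
    (forall i j, i != j -> i != k -> j != k -> 2 <= dz i + dz j).
  exists k => i j ik jk; rewrite /edge_ratio -/(dz i) -/(dz j).
  have di := hk.1 i ik; have dj := hk.1 j jk.
  rewrite gt_eqF ?addr_gt0//.
  have [<-|ij] := eqVneq i j.
    have -> : cabs (vertex i - vertex i) = 0 by rewrite subrr cabsE /= /norm2 expr0n addr0 sqrtr0.
    by rewrite mul0r divr_ge0 ?ltW.
  rewrite cabs_vertexB// ler_pdivrMr ?addr_gt0//.
  by have := hk.2 i j ij ik jk; nra.
have [/existsP[k /eqP dk]|/existsPn dn] := boolP [exists k, dz k == 0].
  have zk : z = vertex k by apply/eqP; rewrite eq_sym -subr_eq0; apply/eqP/cabs0_eq.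
  have dE i : i != k -> dz i = Num.sqrt 3 by move=> ik; rewrite /dz zk cabs_vertexB.
  exists k; split=> [i ik|i j _ ik jk]; first by rewrite dE.
  by rewrite !dE//; nra.
have dpos i : 0 < dz i by rewrite lt_neqAle eq_sym dn dz0.
suff [k hk] : exists k : 'I_3, forall i j, i != j -> i != k -> j != k -> 2 <= dz i + dz j.
  by exists k.
have := fermat_triangle z; rewrite -/(\sum_k dz k) !big_ord_recl big_ord0 addr0 /=.
set a := dz _; set b := dz _; set c := dz _ => h.
pose o0 : 'I_3 := @Ordinal 3 0 isT; pose o1 : 'I_3 := @Ordinal 3 1 isT.
pose o2 : 'I_3 := @Ordinal 3 2 isT.
have ea : dz o0 = a by congr dz; apply/val_inj.
have eb : dz o1 = b by congr dz; apply/val_inj.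
have ec : dz o2 = c by congr dz; apply/val_inj.
have ordE (i : 'I_3) : [\/ i = o0, i = o1 | i = o2].
  by case: i => -[|[|[|//]]] ?; [apply: Or31|apply: Or32|apply: Or33]; apply/val_inj.
have [ab|ab] := leP 2 (a + b); [exists o2|have [bc|bc] := leP 2 (b + c); [exists o0|exists o1]];
  move=> i j; case: (ordE i) => ->; case: (ordE j) => -> //=; rewrite ?ea ?eb ?ec; lra.
Qed.

End triangle.

(** * Functions with three values, each of mass below 1/2 *)

Section upper_bounds.
Context {R : realType} {d : measure_display} {T : measurableType d}.
Variables (mu : {measure set T -> \bar R}) (D : set T).
Hypotheses (mD : measurable D) (muD : mu D = 1%E).

(** Removing a null set from [E] preserves its mass, and two sets of mass above 1/2 intersect. *)
Lemma ae_meet (P : T -> Prop) : (\forall x \ae mu, D x -> P x) -> forall E F,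
  measurable E -> measurable F -> E `<=` D -> F `<=` D ->
  ((1 / 2)%:E < mu E)%E -> ((1 / 2)%:E < mu F)%E -> exists x, [/\ E x, F x & P x].
Proof.
move=> [N [mN N0 PN]] E F mE mF ED FD hE hF.
have mEN : measurable (E `\` N) by exact: measurableD.
have e : mu (E `\` N) = mu E.
  apply: measure_full => //.
  apply: (@subset_measure0 _ _ _ _ _ N) => //; first exact: measurableD.
  by move=> x [Ex nEN]; apply: contrapT => Nx; apply: nEN.
have [||x [[Ex Nx] Fx]] := measure_half_meet mD muD mEN mF _ FD _ hF.
- by move=> x [/ED].
- by rewrite e.
exists x; split => //; apply: contrapT => nP; apply: Nx; apply: PN => /= h.
by apply: nP; apply: h; exact: ED.
Qed.

Lemma Lam_le1 (g : T -> R[i]) S z : (Lam mu D g S z <= 1)%E.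
Proof.
apply: ge_ereal_sup => y /= hy.
have half : ((1 / 2)%:E < mu D)%E by rewrite muD lte_fin; lra.
have [x [_ _ yx]] := ae_meet hy mD mD (@subset_refl _ D) (@subset_refl _ D) half half.
by apply: le_trans yx _; rewrite lee_fin; exact: edge_ratio_le1.
Qed.

Lemma Lam_sup_le1 (g : T -> R[i]) : (Lam_sup mu D g <= 1)%E.
Proof. by apply: ge_ereal_sup => _ [S _ [z _ <-]]; exact: Lam_le1. Qed.

Variable c : T -> 'I_3.
Hypothesis mc : forall k, measurable (D `&` [set x | c x = k]).

Lemma triangle_cmeas : cmeas D (vertex \o c : T -> R[i]).
Proof.
have m (u : 'I_3 -> R) : measurable_fun D (u \o c).
  move=> _ Y mY.
  rewrite (_ : D `&` _ = \bigcup_(k in [set k | Y (u k)]) (D `&` [set x | c x = k])).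
    by apply: fin_bigcup_measurable => //; exact: finite_finset.
  apply/seteqP; split => [x [Dx Yx]|x [k Yk [Dx /= ck]]]; last by split => //=; rewrite ck.
  by exists (c x).
by split; [exact: (m (fun k => complex.Re (vertex k)))|exact: (m (fun k => complex.Im (vertex k)))].
Qed.

Lemma triangle_Linfty : Linfty mu D (vertex \o c : T -> R[i]).
Proof.
split; first exact: triangle_cmeas.
by exists 1; apply: aeW => x _; rewrite (cabs_vertex (c x)).
Qed.

(** The complement of the class [k] attached to [z] has mass above 1/2, and so has its preimage
    under [S]. They meet in a point [x] where neither [c x] nor [c (S x)] is [k], outside any given
    null set. *)
Lemma triangle_Lam_sup_le :
  (forall k, (mu (D `&` [set x | c x = k]) < (1 / 2)%:E)%E) ->
  (Lam_sup mu D (vertex \o c : T -> R[i]) <= (Num.sqrt 3 / 2)%:E)%E.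
Proof.
move=> small; apply: ge_ereal_sup => _ [S autS [z _ <-]].
apply: ge_ereal_sup => y /= hy.
have [A [B [S' [[mA mB AD BD _] [[_ _ _ mS _] muS]]]]] := autS.
have [k hk] := edge_ratio_vertex z.
have Doo : (mu D < +oo)%E by rewrite muD ltry.
pose E := D `\` (D `&` [set x | c x = k]).
have mE : measurable E by exact: measurableD.
have ED : E `<=` D by exact: subDsetl.
have hE : ((1 / 2)%:E < mu E)%E.
  have -> : mu E = (mu D - mu (D `&` (D `&` [set x | c x = k])))%E.
    by apply: measureD => //; exact: Doo.
  rewrite setIA setIid muD; have := small k.
  have : mu (D `&` [set x | c x = k]) \is a fin_num.
    exact: (fin_measure_sub mD Doo).
  case: (mu _) => // t _; rewrite -EFinB !lte_fin; exact: lt_half_compl.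
have mSE : measurable (A `&` S @^-1` E) by exact: mS.
have hSE : ((1 / 2)%:E < mu (A `&` S @^-1` E))%E by rewrite muS.
have [|x [[Dx nx] [_ [DSx nSx]] yx]] := ae_meet hy mE mSE ED _ hE hSE.
  by move=> x [/AD].
apply: le_trans yx _; rewrite lee_fin; apply: hk.
  by apply/eqP => cx; apply: nx.
by apply/eqP => cx; apply: nSx.
Qed.

End upper_bounds.

(** * Values of Lambda *)
Section lambda_values.
Context {R : realType} {d : measure_display} {T : measurableType d}.
Variables (mu : {measure set T -> \bar R}) (D : set T).

(** The chain [l <= Lam g S z <= Lam_sup g <= l] collapses, and [l] bounds every other supremum from
    below. *)
Lemma Lam_space_attained (g : T -> R[i]) S z (l : \bar R) : Linfty mu D g ->
  is_aut mu D S -> (l <= Lam mu D g S z)%E -> (Lam_sup mu D g <= l)%E ->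
  (forall h, cmeas D h -> (l <= Lam_sup mu D h)%E) ->
  Lam_space mu D = l /\ Lam mu D g S z = Lam_sup mu D g /\ Lam_sup mu D g = Lam_space mu D.
Proof.
move=> [mg _] autS h1 h2 lower.
have h3 := le_Lam_sup g z autS.
have e1 : Lam_sup mu D g = l by apply/eqP; rewrite eq_le h2 (le_trans h1).
have e2 : Lam_space mu D = l.
  apply/eqP; rewrite eq_le; apply/andP; split.
    by rewrite -e1; apply: ereal_inf_lbound; exists g.
  by apply: le_ereal_inf_tmp => _ [h mh <-]; exact: lower.
split => //; split; last by rewrite e1 e2.
by apply/eqP; rewrite eq_le h3 e1.
Qed.

End lambda_values.

(** * Finite spaces *)

Section finite_values.
Context {R : realType}.

Lemma Lam_sup_fin_ge n (g : nat -> R[i]) : (0 < n)%N ->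
  ((Num.sqrt 3 / 2)%:E <= Lam_sup (@mu_fin R n) (Omega_fin n) g)%E.
Proof.
move=> n0; have [S [z [autS h]]] := @Lam_fin_ge R n g n0.
by apply: le_trans h _; exact: le_Lam_sup.
Qed.

Definition color3 (k : nat) : 'I_3 := inord (k.-1 %% 3).

(** A residue class has at most [n / 3] points, rounded up. From [n = 3] on this is less than
    [n / 2] except for [n = 4], where two points are exactly half. *)
Lemma color3_small n k : (3 <= n)%N -> n != 4%N ->
  (mu_fin n (Omega_fin n `&` [set x | color3 x = k]) < (1 / 2)%:E :> \bar R)%E.
Proof.
move=> n3 n4; set E := _ `&` _.
have [a Ea] : finite_set E by apply: sub_finite_set (Omega_fin_finite n); exact: subIsetl.
have an : (a <= (n + 2) %/ 3)%N.
  rewrite -card_le_II -(card_le_eql Ea).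
  (* Points of one colour are separated by their quotients modulo 3. *)
  apply: (@card_le_trans _ _ _ ((fun x => x.-1 %/ 3)%N @` E)).
    suff /inj_card_eq : {in E &, injective (fun x => x.-1 %/ 3)%N}.
      by rewrite card_eq_le => /andP[].
    move=> x y; rewrite !inE => -[Dx /= cx] [Dy /= cy] e.
    have : (x.-1 %% 3 = y.-1 %% 3)%N.
      have := congr1 val (etrans cx (esym cy)); rewrite /color3 /= !inordK ?ltn_mod//.
    by move: Dx Dy; rewrite /Omega_fin /=; lia.
  apply: subset_card_le => _ [x [Dx _] <-] /=.
  by move: Dx; rewrite /Omega_fin /=; lia.
rewrite (mu_fin_card n Ea) lte_fin mulrC ltr_pdivrMr ?ltr0n; last by lia.
have : (a.*2 < n)%N by lia.
by rewrite -muln2 -(ltr_nat R) natrM; lra.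
Qed.

Lemma edge_ratio_end (p q : R[i]) : edge_ratio p p q = 1 /\ edge_ratio q p q = 1.
Proof.
have c0 (w : R[i]) : cabs (w - w) = 0 by rewrite subrr cabsE /= /norm2 expr0n addr0 sqrtr0.
have cC (u v : R[i]) : cabs (u - v) = cabs (v - u).
  by rewrite !cabsE; case: u v => [u1 u2] [v1 v2] /=; congr Num.sqrt; ring.
rewrite /edge_ratio !c0 add0r addr0 (cC q p).
by split; case: eqP => // /eqP h; rewrite divff.
Qed.

(* Taking [z := g 1], every pair [(k, S k)] contains the point 1, where the
   ratio is 1. *)
Lemma Lam_sup_fin_ge1 n (g : nat -> R[i]) : (0 < n <= 2)%N ->
  (1 <= Lam_sup (@mu_fin R n) (Omega_fin n) g)%E.
Proof.
move=> /andP[n0 n2]; pose S k := (n.+1 - k)%N.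
have SS k : Omega_fin n k -> Omega_fin n (S k) /\ S (S k) = k.
  by rewrite /Omega_fin /S /=; lia.
apply: le_trans (le_Lam_sup g (g 1%N) (fin_is_aut SS SS)).
apply: (@le_Lam _ _ _ _ _ _ _ _ (Omega_fin n)) => //; first by rewrite setDv measure0.
move=> k Dk _; change (1 <= edge_ratio (g 1%N) (g k) (g (S k))).
have [_ e2] := edge_ratio_end (g k) (g 1%N).
have [->|Sk] : k = 1%N \/ S k = 1%N by move: Dk; rewrite /Omega_fin /S /=; lia.
  by have [-> _] := edge_ratio_end (g 1%N) (g (S 1%N)).
by rewrite Sk e2.
Qed.

Lemma Lambda_fin_attained n : (0 < n)%N -> n != 4%N ->
  @Lambda_fin R n = (if (n <= 2)%N then 1 else Num.sqrt 3 / 2)%:E /\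
  exists (g : nat -> R[i]) S z, Linfty (@mu_fin R n) (Omega_fin n) g /\
    is_aut (@mu_fin R n) (Omega_fin n) S /\
    Lam (@mu_fin R n) (Omega_fin n) g S z = Lam_sup (@mu_fin R n) (Omega_fin n) g /\
    Lam_sup (@mu_fin R n) (Omega_fin n) g = @Lambda_fin R n.
Proof.
move=> n0 n4; case: ifPn => n2.
  (* For a constant function and [z] equal to the constant, every ratio is 0/0 = 1. *)
  pose o : R[i] := 0; pose g : nat -> R[i] := fun=> o.
  have Lg : Linfty (@mu_fin R n) (Omega_fin n) g.
    split => //; exists 0; apply: aeW => x _.
    by rewrite cabsE /= /norm2 expr0n addr0 sqrtr0.
  have autS : is_aut (@mu_fin R n) (Omega_fin n) id by apply: (@fin_is_aut _ _ _ id).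
  have h1 : (1%:E <= Lam (@mu_fin R n) (Omega_fin n) g id o)%E.
    apply: (@le_Lam _ _ _ _ _ _ _ _ (Omega_fin n)) => //; first by rewrite setDv measure0.
    move=> k _ _; change (1 <= edge_ratio o o o).
    by have [-> _] := edge_ratio_end o o.
  have [e [e1 e2]] := Lam_space_attained Lg autS h1
    (Lam_sup_le1 (measurable_nat _) (mu_fin_Omega n0) g)
    (fun h _ => Lam_sup_fin_ge1 h (introT andP (conj n0 n2))).
  by split => //; exists g, id, o.
rewrite -ltnNge in n2.
have mc k : measurable (Omega_fin n `&` [set x | color3 x = k]) by [].
have [S [z [autS h]]] := @Lam_fin_ge R n (vertex \o color3) n0.
have [e [e1 e2]] := Lam_space_attained (triangle_Linfty (mu_fin n) mc) autS h
  (triangle_Lam_sup_le (measurable_nat _) (mu_fin_Omega n0) mc (fun k => color3_small k n2 n4))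
  (fun h _ => Lam_sup_fin_ge h n0).
split => //; exists (vertex \o color3), S, z.
by split; first exact: (triangle_Linfty (mu_fin n) mc).
Qed.

End finite_values.

(** * The unit interval *)

Section infinite_value.
Context {R : realType}.
Local Notation LT := (@lebesgueType R).

Definition third (x : LT) : 'I_3 :=
  if x < (1 / 3 : R) then inord 0 else if x < (2 / 3 : R) then inord 1 else inord 2.

(** The three classes are intervals with different kinds of endpoints; the common closed third
    containing each of them gives one estimate of measure for all. *)
Lemma third_itv (k : 'I_3) : exists J : interval R,
  (@Omega_inf R : set LT) `&` [set x | third x = k] = [set` J] /\
  [set` J] `<=` `[k%:R / 3, k%:R / 3 + 1 / 3]%classic.
Proof.
have v (j : nat) (x : LT) : (j < 3)%N -> (third x = j :> nat) <->
    (j = if x < (1 / 3 : R) then 0%N else if x < (2 / 3 : R) then 1%N else 2%N).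
  by move=> j3; rewrite /third; case: ifP => _; [|case: ifP => _]; rewrite inordK.
have tE (x : LT) : third x = k <->
    (k = (if x < (1 / 3 : R) then 0%N else if x < (2 / 3 : R) then 1%N else 2%N) :> nat).
  rewrite -v//; split => [->//|h]; exact/val_inj.
case: k tE => -[|[|[|//]]] hk tE /=.
- exists `[0, 1 / 3[; split; last by move=> x /=; rewrite !in_itv/= => /andP[? ?]; lra.
  apply/seteqP; split => x /=; rewrite /Omega_inf /= !in_itv/=.
    by move=> [/andP[-> _] /tE]; case: ifP => //; case: ifP.
  by move=> /andP[x0 x1]; split; [lra|apply/tE; rewrite x1].
- exists `[1 / 3, 2 / 3[; split; last by move=> x /=; rewrite !in_itv/= => /andP[? ?]; lra.
  apply/seteqP; split => x /=; rewrite /Omega_inf /= !in_itv/=.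
    by move=> [_ /tE]; case: ltP => // _; case: ltP.
  by move=> /andP[x0 x1]; split; [lra|apply/tE; rewrite x1 ltNge x0].
- exists `[2 / 3, 1]; split; last by move=> x /=; rewrite !in_itv/= => /andP[? ?]; lra.
  apply/seteqP; split => x /=; rewrite /Omega_inf /= !in_itv/=.
    by move=> [/andP[_ ->] /tE]; case: ltP => // _; case: ltP.
  move=> /andP[x0 x1]; split; first by lra.
  by apply/tE; rewrite !ltNge x0 /= (le_trans _ x0)//; lra.
Qed.

Lemma third_measurable k : measurable ((@Omega_inf R : set LT) `&` [set x | third x = k]).
Proof.
by have [J [-> _]] := third_itv k; apply: borel_lebesgue; exact: measurable_itv.
Qed.

Lemma third_small k :
  (lam ((@Omega_inf R : set LT) `&` [set x | third x = k]) < (1 / 2)%:E)%E.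
Proof.
have [J [e sub]] := third_itv k.
apply: (@le_lt_trans _ _ (lam `[k%:R / 3, k%:R / 3 + 1 / 3]%classic)).
  apply: le_measure; rewrite ?inE; [exact: third_measurable| |by rewrite e].
  by apply: borel_lebesgue; exact: measurable_itv.
rewrite lam_itv; last by lra.
by rewrite addrC addKr lte_fin; lra.
Qed.

Lemma Lambda_inf_attained : @Lambda_inf R = (Num.sqrt 3 / 2)%:E /\
  exists (g : R -> R[i]) S z, Linfty (@mu_inf R) (@Omega_inf R) g /\
    is_aut (@mu_inf R) (@Omega_inf R) S /\
    Lam (@mu_inf R) (@Omega_inf R) g S z = Lam_sup (@mu_inf R) (@Omega_inf R) g /\
    Lam_sup (@mu_inf R) (@Omega_inf R) g = @Lambda_inf R.
Proof.
have [S [z [autS h]]] := Lam_inf_ge (triangle_cmeas third_measurable).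
have lower (g : LT -> R[i]) : cmeas (@Omega_inf R : set LT) g ->
    ((Num.sqrt 3 / 2)%:E <= Lam_sup lam (@Omega_inf R : set LT) g)%E.
  move=> mg; have [S' [z' [autS' h']]] := Lam_inf_ge mg.
  by apply: le_trans h' _; exact: le_Lam_sup.
have [e [e1 e2]] := Lam_space_attained (triangle_Linfty lam third_measurable) autS h
  (triangle_Lam_sup_le measurable_Omega_inf lam_Omega_inf third_measurable third_small) lower.
split => //; exists (vertex \o third), S, z.
by split; first exact: (triangle_Linfty lam third_measurable).
Qed.

End infinite_value.

Theorem theoremA1 (R : realType) :
  (* Lambda_1 = Lambda_2 = 1 *)
  (@Lambda_fin R 1 = 1%:E /\ @Lambda_fin R 2 = 1%:E) /\
  (* sqrt 3 / 2 <= Lambda_4 <= 1 *)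
  ((Num.sqrt 3 / 2)%:E <= @Lambda_fin R 4 <= 1%:E)%E /\
  (* Lambda_n = sqrt 3 / 2 for n in (N u {oo}) \ {1, 2, 4} *)
  (forall n : nat, (1 <= n)%N -> n \notin [:: 1%N; 2%N; 4%N] ->
     @Lambda_fin R n = (Num.sqrt 3 / 2)%:E) /\
  @Lambda_inf R = (Num.sqrt 3 / 2)%:E /\
  (* attainment for n <> 4 *)
  (forall n : nat, (1 <= n)%N -> n != 4%N ->
     exists (g : nat -> R[i]) (S : nat -> nat) (z : R[i]),
       Linfty (@mu_fin R n) (Omega_fin n) g /\
       is_aut (@mu_fin R n) (Omega_fin n) S /\
       Lam (@mu_fin R n) (Omega_fin n) g S z
         = Lam_sup (@mu_fin R n) (Omega_fin n) g /\
       Lam_sup (@mu_fin R n) (Omega_fin n) g = @Lambda_fin R n) /\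
  (exists (g : R -> R[i]) (S : R -> R) (z : R[i]),
       Linfty (@mu_inf R) (@Omega_inf R) g /\
       is_aut (@mu_inf R) (@Omega_inf R) S /\
       Lam (@mu_inf R) (@Omega_inf R) g S z = Lam_sup (@mu_inf R) (@Omega_inf R) g /\
       Lam_sup (@mu_inf R) (@Omega_inf R) g = @Lambda_inf R).
Proof.
have fin n : (1 <= n)%N -> n != 4%N -> _ := @Lambda_fin_attained R n.
have [inf1 inf2] := @Lambda_inf_attained R.
split; first by split; [exact: (fin 1%N isT isT).1|exact: (fin 2%N isT isT).1].
split.
  apply/andP; split.
    by apply: le_ereal_inf_tmp => _ [g _ <-]; exact: Lam_sup_fin_ge.
  (* No ratio exceeds 1, so any function bounds the infimum by 1; the zero function is used. *)
  apply: (@le_trans _ _ (Lam_sup (@mu_fin R 4) (Omega_fin 4) (fun=> 0))).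
    by apply: ereal_inf_lbound; exists (fun=> 0).
  by apply: Lam_sup_le1 => //; exact: mu_fin_Omega.
split.
  move=> n n1; rewrite !inE !negb_or => /and3P[n1' n2' n4'].
  rewrite (fin n n1 n4').1; case: ifPn => // n2.
  by case: n n1 n1' n2' n2 {n4'} => [|[|[|]]].
split; first exact: inf1.
by split; [move=> n n1 n4; exact: (fin n n1 n4).2|exact: inf2].
Qed.
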